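(* If there is $\varepsilon > 0$ such that \textsc{Total Dominating Set} can be solved in time $\mathcal{O}^*((4 - \varepsilon)^{\operatorname{pw}(G)})$, where $G$ is the input graph, then SETH is false.
   Context: \textsc{Total Dominating Set}: given an undirected graph $G=(V,E)$ and an integer $b$, decide whether there is $X \subseteq V$, $|X| \le b$, with $\bigcup_{v\in X} N(v) = V$ (open neighborhoods). $\operatorname{pw}(G)$ is the pathwidth of $G$ (a path decomposition of that width may be assumed given). $\mathcal{O}^*$ suppresses polynomial factors. SETH: with $c_q = \inf\{\delta : q\text{-SAT can be solved in time } \mathcal{O}(2^{\delta n})\}$, SETH states $\lim_{q\to\infty} c_q = 1$. *)

(* Defs.v *)
From mathcomp Require Import boolp classical_sets reals topology normedtype.
From mathcomp Require Import sequences exp.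
From mathcomp Require Import all_boot all_order all_algebra.

Set Implicit Arguments.
Unset Strict Implicit.
Unset Printing Implicit Defensive.

Import Order.TTheory GRing.Theory Num.Theory.
Import numFieldNormedType.Exports.

Local Open Scope ring_scope.

(** * Machine model

    Algorithms are programs of the WHILE language of N. D. Jones
    (Computability and Complexity from a Programming Perspective): finitely many
    variables holding binary trees (LISP cells), with constant-cost access to
    the root of a tree only.  WHILE programs and logarithmic-cost RAMs simulate
    each other with a slowdown that is polylogarithmic in the running time (a
    RAM memory is kept in a binary trie indexed by address bits; conversely
    cells are pointers), so that neither the exponents c_q nor a bound of the
    form O*(a^pw) depends on which of the two is used. *)

Inductive tree : Type := Leaf | Node of tree & tree.

Fixpoint tsize (t : tree) : nat :=
  if t is Node l r then (tsize l + tsize r).+1 else 1%N.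

Inductive expr : Type :=
  | Var of nat
  | ELeaf
  | ENode of expr & expr
  | EFst of expr
  | ESnd of expr.

Definition store := nat -> tree.

Definition upd (s : store) (x : nat) (t : tree) : store :=
  fun y => if y == x then t else s y.

Fixpoint eval (s : store) (e : expr) : tree :=
  match e with
  | Var x => s x
  | ELeaf => Leaf
  | ENode e1 e2 => Node (eval s e1) (eval s e2)
  | EFst e1 => if eval s e1 is Node l _ then l else Leaf
  | ESnd e1 => if eval s e1 is Node _ r then r else Leaf
  end.

Fixpoint ecost (e : expr) : nat :=
  match e with
  | Var _ | ELeaf => 1
  | ENode e1 e2 => (ecost e1 + ecost e2).+1
  | EFst e1 | ESnd e1 => (ecost e1).+1
  end%N.

Inductive cmd : Type :=
  | Assign of nat & expr
  | Seq of cmd & cmd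
  | If of expr & cmd & cmd
  | While of expr & cmd.

Definition is_node (t : tree) : bool := if t is Node _ _ then true else false.

(** [exec c s t s']: started in [s], [c] halts after [t] steps in [s']. *)
Inductive exec : cmd -> store -> nat -> store -> Prop :=
  | ExecAssign x e s :
      exec (Assign x e) s (ecost e).+1 (upd s x (eval s e))
  | ExecSeq c1 c2 s s1 s2 t1 t2 :
      exec c1 s t1 s1 -> exec c2 s1 t2 s2 ->
      exec (Seq c1 c2) s (t1 + t2)%N s2
  | ExecIf e c1 c2 s s1 t :
      exec (if is_node (eval s e) then c1 else c2) s t s1 ->
      exec (If e c1 c2) s ((ecost e).+1 + t)%N s1
  | ExecWhileF e c s :
      ~~ is_node (eval s e) -> exec (While e c) s (ecost e).+1 s
  | ExecWhileT e c s s1 s2 t1 t2 :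
      is_node (eval s e) -> exec c s t1 s1 -> exec (While e c) s1 t2 s2 ->
      exec (While e c) s ((ecost e).+1 + (t1 + t2))%N s2.

Definition enc_bool (b : bool) : tree := if b then Node Leaf Leaf else Leaf.

(** Numbers are encoded in unary.  In the problems below they index variables
    or bound a cardinality, so this costs only a polynomial factor compared
    with binary notation. *)
Definition enc_nat (n : nat) : tree := iter n (Node Leaf) Leaf.

Definition enc_list (A : Type) (enc : A -> tree) (l : seq A) : tree :=
  foldr (fun a t => Node (enc a) t) Leaf l.

(** Input and output are in variable 0; all other variables start as [Leaf]. *)
Definition decides_within (R : realType) (P : cmd) (input : tree) (answer : bool)
    (T : R) : Prop :=
  exists (t : nat) (s : store),
    [/\ exec P (upd (fun=> Leaf) 0 input) t s, s 0%N = enc_bool answer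
      & t%:R <= T].

(** * Graphs, path decompositions, total dominating sets *)

Record sgraph : Type := SGraph {
  nverts : nat;
  adj : rel 'I_nverts;
  adj_sym : symmetric adj;
  adj_irr : irreflexive adj }.

Definition nbhd (G : sgraph) (v : 'I_(nverts G)) : {set 'I_(nverts G)} :=
  [set u | adj v u].

Definition total_dominating (G : sgraph) (X : {set 'I_(nverts G)}) : bool :=
  \bigcup_(v in X) nbhd v == [set: 'I_(nverts G)].

Definition has_tds (G : sgraph) (b : nat) : bool :=
  [exists X : {set 'I_(nverts G)}, (#|X| <= b)%N && total_dominating X].

Record path_decomp (G : sgraph) (D : seq {set 'I_(nverts G)}) : Prop := {
  pd_vertex : forall v, exists2 B, B \in D & v \in B;
  pd_edge : forall u v, adj u v -> exists2 B, B \in D & (u \in B) && (v \in B);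
  pd_interval : forall i j k, (i <= j)%N -> (j <= k)%N -> (k < size D)%N ->
    nth set0 D i :&: nth set0 D k \subset nth set0 D j }.

(** Truncated subtraction: the graph without vertices gets width 0, not -1. *)
Definition width (G : sgraph) (D : seq {set 'I_(nverts G)}) : nat :=
  (\max_(B <- D) #|B|).-1.

Lemma path_decomp_trivial (G : sgraph) :
  path_decomp [:: [set: 'I_(nverts G)]].
Proof.
split.
- by move=> v; exists [set: 'I_(nverts G)]; rewrite ?inE.
- by move=> u v _; exists [set: 'I_(nverts G)]; rewrite ?inE.
- move=> i j k ij jk; rewrite ltnS leqn0 => /eqP k0.
  by move: jk; rewrite k0 leqn0 => /eqP ->; rewrite subsetIr.
Qed.

Definition has_pathwidth_le (G : sgraph) (w : nat) : bool :=
  `[< exists2 D : seq {set 'I_(nverts G)}, path_decomp D & (width D <= w)%N >].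

Lemma has_pathwidth_le_ex (G : sgraph) : exists w, has_pathwidth_le G w.
Proof.
exists (width [:: [set: 'I_(nverts G)]]); apply/asboolP.
by exists [:: [set: 'I_(nverts G)]]; first exact: path_decomp_trivial.
Qed.

Definition pathwidth (G : sgraph) : nat := ex_minn (has_pathwidth_le_ex G).

(** Sets are characteristic vectors, graphs are adjacency matrices. *)
Definition enc_set n (A : {set 'I_n}) : tree :=
  enc_list enc_bool [seq i \in A | i <- enum 'I_n].

Definition enc_graph (G : sgraph) : tree :=
  enc_list (@enc_set _) [seq nbhd v | v <- enum 'I_(nverts G)].

Definition enc_tds (G : sgraph) (b : nat) (D : seq {set 'I_(nverts G)}) : tree :=
  Node (enc_graph G) (Node (enc_nat b) (enc_list (@enc_set _) D)).

(** Total Dominating Set can be solved in time O*(a^pw(G)), where a path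
    decomposition of width pw(G) is part of the input.  An algorithm that gets
    only [G] and [b] is a special case: it ignores the decomposition. *)
Definition tds_solvable_in (R : realType) (a : R) : Prop :=
  exists (P : cmd) (C : R) (k : nat),
    forall (G : sgraph) (b : nat) (D : seq {set 'I_(nverts G)}),
      path_decomp D -> width D = pathwidth G ->
      decides_within P (enc_tds b D) (has_tds G b)
        (C * a ^+ pathwidth G * (tsize (enc_tds b D))%:R ^+ k).

(** * Satisfiability and SETH *)

(** [(i, true)] is the i-th variable and [(i, false)] its negation. *)
Definition cnf (n : nat) : Type := seq (seq ('I_n * bool)).

Definition sat n (F : cnf n) : bool :=
  [exists a : {ffun 'I_n -> bool},
     all (fun c => has (fun l : 'I_n * bool => a l.1 == l.2) c) F].

(** A clause is not repeated: otherwise the length of the input, hence the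
    running time, would not be bounded by any function of [n]. *)
Definition qcnf (q : nat) n (F : cnf n) : bool :=
  uniq F && all (fun c => size c <= q)%N F.

Definition enc_cnf n (F : cnf n) : tree :=
  Node (enc_nat n)
    (enc_list (enc_list (fun l : 'I_n * bool => Node (enc_nat l.1) (enc_bool l.2)))
       F).

(** q-SAT can be solved in time O(2^(delta n)), [n] the number of variables. *)
Definition qsat_solvable_in (R : realType) (q : nat) (delta : R) : Prop :=
  exists (P : cmd) (C : R), forall (n : nat) (F : cnf n), qcnf q F ->
    decides_within P (enc_cnf F) (sat F) (C * 2 `^ (delta * n%:R)).

Definition sat_exponent (R : realType) (q : nat) : R :=
  inf [set delta : R | qsat_solvable_in q delta]%classic.

Definition SETH (R : realType) : Prop :=
  (sat_exponent R q @[q --> \oo] --> (1 : R))%classic.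

(* Main.v *)
(** A formula with [n] variables is turned into a graph of pathwidth
    [n / 2 + O(1)], so that an algorithm running in time [O*(a ^ pw)] with
    [a < 4] solves [q]-SAT in time [O*((sqrt a) ^ n)], for every [q].

    The variables are paired into [n / 2] rows, and the clauses, repeated, are
    the columns of a grid.  In each cell two pairs of vertices, each pair being
    the neighbourhood of some vertex, must contribute one vertex each to the
    dominating set; the budget leaves nothing else, and the two choices are the
    values of the two variables of the row.  Consecutive cells of a row share a
    single vertex, which transmits the first bit by being chosen or not and the
    second by being dominated from the left or not; hence one vertex per row in
    each separator.  Both bits can change along a row, but only in one
    direction, so with more repetitions of the formula than possible changes
    some copy sees a constant assignment.  A clique makes the pathwidth known
    exactly. *)

From mathcomp Require Import boolp classical_sets reals topology normedtype.
From mathcomp Require Import sequences exp.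
From mathcomp Require Import all_boot all_order all_algebra.
From mathcomp Require Import zify ring lra.
Require Import Defs.

Set Implicit Arguments.
Unset Strict Implicit.
Unset Printing Implicit Defensive.

Import Order.TTheory GRing.Theory Num.Theory.
Import numFieldNormedType.Exports.

(** A domination requirement is a disjunction: some neighbour is chosen. Between consecutive columns
    it can therefore only express an implication, namely that a bit set on the left is also set on
    the right; equality of the two bits is out of reach, and this is why the formula is repeated.
    The assumed algorithm expects a decomposition of optimal width, so an upper bound on the
    pathwidth is not enough. A clique lies inside one bag of every decomposition; it is given as
    many vertices as the other bags may have, and one of its vertices doubles as the dominator of
    all that should impose no condition. The hypothesis speaks of concrete programs, so the
    reduction has to be one as well. Instead of being written out, it is composed from a class of
    functions that is closed under composition, pairing, tests and folds with additively growing
    accumulator. The clause width [q] only influences the size of the formula, hence a polynomial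
    factor. One exponent below 1 then serves all [q] at once, which contradicts the limit in
    SETH. *)

Definition encoder (A : Type) := A -> tree.
Existing Class encoder.
Definition code (A : Type) (eA : encoder A) (x : A) : tree := eA x.
Arguments code {A eA} x.

#[export] Instance enc_of_nat : encoder nat := enc_nat.
#[export] Instance enc_of_bool : encoder bool := enc_bool.
#[export] Instance enc_of_unit : encoder unit := fun=> Leaf.
#[export] Instance enc_of_prod A B (eA : encoder A) (eB : encoder B) :
  encoder (A * B) := fun x => Node (eA x.1) (eB x.2).
#[export] Instance enc_of_seq A (eA : encoder A) : encoder (seq A) := enc_list eA.

Definition esize A {eA : encoder A} (x : A) : nat := tsize (code x).
Arguments esize {A eA} x.

Lemma tsize_gt0 t : 0 < tsize t. Proof. by case: t. Qed.

Lemma esize_gt0 A (eA : encoder A) (x : A) : 0 < esize x.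
Proof. exact: tsize_gt0. Qed.

Lemma esize_pair A B (eA : encoder A) (eB : encoder B) (x : A) (y : B) :
  esize (x, y) = (esize x + esize y).+1.
Proof. by []. Qed.

Lemma esize_cons A (eA : encoder A) (x : A) (s : seq A) :
  esize (x :: s) = (esize x + esize s).+1.
Proof. by []. Qed.

Lemma esize_nat n : esize n = n.*2.+1.
Proof.
rewrite /esize /code /enc_of_nat /enc_nat.
by elim: n => [|n] //= ->; rewrite add1n doubleS.
Qed.

Lemma esize_bool (b : bool) : esize b <= 3. Proof. by case: b. Qed.

Lemma esize_seq A (eA : encoder A) (s : seq A) :
  esize s = (\sum_(x <- s) (esize x).+1).+1.
Proof.
by elim: s => [|x s IHs]; rewrite ?big_nil // esize_cons big_cons IHs; lia.
Qed.

(** * Polynomial bounds *)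

Definition polyb (A : Type) (m f : A -> nat) : Prop :=
  exists c k, forall x, f x <= c * m x ^ k.

Section PolyBounds.
Variables (A : Type) (m : A -> nat).
Hypothesis m_gt0 : forall x, 0 < m x.

Lemma polyb_le (f g : A -> nat) :
  (forall x, f x <= g x) -> polyb m g -> polyb m f.
Proof.
move=> fg [c [k H]]; exists c, k => x; exact: leq_trans (fg x) (H x).
Qed.

Lemma polyb_const c : polyb m (fun=> c).
Proof. by exists c, 0 => x; rewrite expn0 muln1. Qed.

Lemma polyb_id : polyb m m.
Proof. by exists 1, 1 => x; rewrite mul1n. Qed.

Lemma polyb_add (f g : A -> nat) :
  polyb m f -> polyb m g -> polyb m (fun x => f x + g x).
Proof.
move=> [c [k H]] [d [l K]]; exists (c + d), (maxn k l) => x.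
rewrite mulnDl leq_add //.
- by apply: leq_trans (H x) _; rewrite leq_mul2l leq_pexp2l ?leq_maxl ?orbT.
- by apply: leq_trans (K x) _; rewrite leq_mul2l leq_pexp2l ?leq_maxr ?orbT.
Qed.

Lemma polyb_mul (f g : A -> nat) :
  polyb m f -> polyb m g -> polyb m (fun x => f x * g x).
Proof.
move=> [c [k H]] [d [l K]]; exists (c * d), (k + l) => x.
by rewrite expnD mulnACA leq_mul.
Qed.

Lemma polyb_comp (B : Type) (mB : B -> nat) (f : A -> B) (g : B -> nat) :
  polyb m (fun x => mB (f x)) -> polyb mB g -> polyb m (fun x => g (f x)).
Proof.
move=> [c [k H]] [d [l K]]; exists (d * c ^ l), (k * l) => x.
apply: leq_trans (K _) _; rewrite -mulnA leq_mul2l expnM -expnMn.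
by case: l K => [|l] _; rewrite ?expn0 ?leqnn ?orbT // leq_exp2r ?H ?orbT.
Qed.

End PolyBounds.

(** * Polynomial-time functions *)

(* Register 0 holds the argument and then the value, register 1 a stack that
   has to be restored, register 2 is scratch space.  Because of sharing, the
   running time does not bound the size of the value. *)
Definition ptime A B (eA : encoder A) (eB : encoder B) (f : A -> B) : Prop :=
  polyb esize (fun x => esize (f x)) /\
  exists (P : cmd) (T : A -> nat), polyb esize T /\
    forall s x, s 0 = code x -> exists t s',
      [/\ exec P s t s', s' 0 = code (f x), t <= T x
        & forall y, y != 0 -> y != 2 -> s' y = s y].
Arguments ptime {A B eA eB} f.

Section Combinators.
Variables (X A B : Type) (eX : encoder X) (eA : encoder A) (eB : encoder B).

Lemma ptime_ext (f g : X -> A) : f =1 g -> ptime f -> ptime g.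
Proof.
move=> fg [Sf [P [T [PT H]]]]; split.
  by apply: polyb_le Sf => x; rewrite fg.
by exists P, T; split=> // s x /H[t [s']]; rewrite fg; exists t, s'.
Qed.

Lemma ptime_expr (f : X -> A) e :
  polyb esize (fun x => esize (f x)) ->
  (forall s x, s 0 = code x -> eval s e = code (f x)) -> ptime f.
Proof.
move=> Sf He; split=> //; exists (Assign 0 e), (fun=> (ecost e).+1).
split; first exact: polyb_const.
move=> s x sx; exists (ecost e).+1, (upd s 0 (eval s e)); split=> //.
- exact: ExecAssign.
- by rewrite /upd /= (He s x).
- by move=> y; rewrite /upd => /negPf->.
Qed.

Lemma ptime_comp (f : X -> A) (g : A -> B) :
  ptime f -> ptime g -> ptime (fun x => g (f x)).
Proof.
move=> [Sf [P [T [PT HP]]]] [Sg [Q [U [PU HQ]]]]; split.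
  exact: (polyb_comp (mB := esize) (g := fun y => esize (g y))).
exists (Seq P Q), (fun x => T x + U (f x)); split.
  by apply: polyb_add => //; [exact: esize_gt0 | exact: polyb_comp PU].
move=> s x /HP[t [s1 [e1 /HQ[u [s2 [e2 v2 l2 k2]]] l1 k1]]].
exists (t + u), s2; split=> //; first exact: ExecSeq e1 e2.
- exact: leq_add.
- by move=> y y0 y2; rewrite k2 ?k1.
Qed.

End Combinators.

Section Projections.
Variables (X A B : Type) (eX : encoder X) (eA : encoder A) (eB : encoder B).

Fixpoint quote_tree (t : tree) : expr :=
  if t is Node l r then ENode (quote_tree l) (quote_tree r) else ELeaf.

Lemma eval_quote s t : eval s (quote_tree t) = t.
Proof. by elim: t => //= l -> r ->. Qed.

Lemma ptime_const (a : A) : ptime (fun _ : X => a).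
Proof.
apply: (@ptime_expr _ _ _ _ _ (quote_tree (code a))) => [|s x _].
  exact: polyb_const.
exact: eval_quote.
Qed.

Lemma ptime_id : ptime (fun x : X => x).
Proof. by apply: (@ptime_expr _ _ _ _ _ (Var 0)) => //; exact: polyb_id. Qed.

(** A change of type that leaves the tree as it is costs nothing. It covers constructors: a cons is
    coded like a pair, a successor like a pair with [tt]. *)
Lemma ptime_recode (f : X -> A) (g : A -> B) :
  (forall x, code (g x) = code x) -> ptime f -> ptime (fun x => g (f x)).
Proof.
move=> gE [Sf [P [T [PT HP]]]]; split.
  by apply: polyb_le Sf => x; rewrite /esize gE.
by exists P, T; split=> // s x /HP[t [s' H]]; exists t, s'; rewrite gE.
Qed.

Lemma ptime_fst (f : X -> A * B) : ptime f -> ptime (fun x => (f x).1).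
Proof.
move=> pf; apply: (ptime_comp pf (g := fst)).
apply: (@ptime_expr _ _ _ _ _ (EFst (Var 0))) => [|s x /= ->//].
apply: (polyb_le _ (polyb_id _)) => -[a b] /=; rewrite esize_pair; lia.
Qed.

Lemma ptime_snd (f : X -> A * B) : ptime f -> ptime (fun x => (f x).2).
Proof.
move=> pf; apply: (ptime_comp pf (g := snd)).
apply: (@ptime_expr _ _ _ _ _ (ESnd (Var 0))) => [|s x /= ->//].
apply: (polyb_le _ (polyb_id _)) => -[a b] /=; rewrite esize_pair; lia.
Qed.

Definition push : cmd := Assign 1 (ENode (Var 0) (Var 1)).

(** The stack keeps the argument while [f] runs and the value of [f] while [g] runs; register 2
    holds the argument during the exchange. *)
Lemma ptime_pair (f : X -> A) (g : X -> B) :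
  ptime f -> ptime g -> ptime (fun x => (f x, g x)).
Proof.
move=> [Sf [P [T [PT HP]]]] [Sg [Q [U [PU HQ]]]]; split.
  apply: (@polyb_le _ _ _ (fun x => esize (f x) + esize (g x) + 1)) => [x|].
    by rewrite esize_pair addn1.
  by do 2?[apply: polyb_add => //; first exact: esize_gt0]; exact: polyb_const.
exists (Seq push (Seq P (Seq (Assign 2 (EFst (Var 1)))
  (Seq (Assign 1 (ENode (Var 0) (ESnd (Var 1)))) (Seq (Assign 0 (Var 2))
  (Seq Q (Seq (Assign 0 (ENode (EFst (Var 1)) (Var 0)))
   (Assign 1 (ESnd (Var 1)))))))))), (fun x => T x + U x + 24); split.
  by do 2?[apply: polyb_add => //; first exact: esize_gt0]; exact: polyb_const.
move=> s x sx.
set s1 := upd s 1 (Node (s 0) (s 1)).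
have [|t1 [s2 [e1 v1 l1 k1]]] := HP s1 x; first by [].
set s3 := upd s2 2 (eval s2 (EFst (Var 1))).
set s4 := upd s3 1 (eval s3 (ENode (Var 0) (ESnd (Var 1)))).
set s5 := upd s4 0 (eval s4 (Var 2)).
have [|t2 [s6 [e2 v2 l2 k2]]] := HQ s5 x.
  by rewrite /s5 /s4 /s3 /upd /= k1.
set s7 := upd s6 0 (eval s6 (ENode (EFst (Var 1)) (Var 0))).
eexists _, _; split.
- do 7![eapply ExecSeq; first by [exact: ExecAssign | exact: e1 | exact: e2]].
  exact: ExecAssign.
- by rewrite /= /upd /= k2 //= v2 /s5 /s4 /s3 /upd /= v1.
- by rewrite /=; lia.
- move=> y y0 y2; rewrite /= /upd; have [->|y1] := eqVneq y 1.
    by rewrite /= k2 // /s5 /s4 /s3 /upd /= k1 // /s1 /upd.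
  rewrite /s7 /upd (negPf y0) k2 // /s5 /s4 /s3 /upd (negPf y0) (negPf y1).
  by rewrite (negPf y2) k1 // /s1 /upd (negPf y1).
Qed.

End Projections.

Lemma ptime_if (X A : Type) (eX : encoder X) (eA : encoder A)
    (b : X -> bool) (f g : X -> A) :
  ptime b -> ptime f -> ptime g -> ptime (fun x => if b x then f x else g x).
Proof.
move=> [Sb [O [V [PV HO]]]] [Sf [P [T [PT HP]]]] [Sg [Q [U [PU HQ]]]].
have m0 := @esize_gt0 X eX.
split.
  apply: (@polyb_le _ _ _ (fun x => esize (f x) + esize (g x))) => [x|].
    by case: ifP; rewrite ?leq_addl ?leq_addr.
  exact: polyb_add.
exists (Seq push (Seq O (Seq (Assign 2 (Var 0)) (Seq (Assign 0 (EFst (Var 1)))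
  (Seq (Assign 1 (ESnd (Var 1))) (If (Var 2) P Q)))))),
  (fun x => V x + T x + U x + 24); split.
  by do 3?[apply: polyb_add => //]; exact: polyb_const.
move=> s x sx.
set s1 := upd s 1 (Node (s 0) (s 1)).
have [|t1 [s2 [e1 v1 l1 k1]]] := HO s1 x; first by [].
set s3 := upd s2 2 (eval s2 (Var 0)).
set s4 := upd s3 0 (eval s3 (EFst (Var 1))).
set s5 := upd s4 1 (eval s4 (ESnd (Var 1))).
have s5x : s5 0 = code x by rewrite /s5 /s4 /s3 /upd /= k1.
have s52 : s5 2 = code (b x) by rewrite /s5 /s4 /s3 /upd /=.
have s5y y : y != 0 -> y != 2 -> s5 y = s y.
  move=> y0 y2; rewrite /s5 /upd; have [->|y1] := eqVneq y 1.
    by rewrite /s4 /s3 /upd /= k1.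
  by rewrite /s4 /s3 /upd (negPf y0) (negPf y2) k1 // /s1 /upd (negPf y1).
have [t2 [s6 [e2 v2 l2 k2]]] : exists t s', [/\ exec (if b x then P else Q) s5 t s',
   s' 0 = code (if b x then f x else g x), t <= T x + U x
   & forall y, y != 0 -> y != 2 -> s' y = s5 y].
  case: (b x).
    have [t [s' [? ? ? ?]]] := HP s5 x s5x; exists t, s'; split=> //; lia.
  have [t [s' [? ? ? ?]]] := HQ s5 x s5x; exists t, s'; split=> //; lia.
eexists; exists s6; split.
- do 5![eapply ExecSeq; first by [exact: ExecAssign | exact: e1]].
  by apply: ExecIf; rewrite [eval _ _]s52; move: e2; case: (b x) => ?; eassumption.
- by [].
- by rewrite /=; lia.
- by move=> y y0 y2; rewrite k2 ?s5y.
Qed.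

(** * Folds over lists *)

Section Fold.
Variables (X A B : Type) (eX : encoder X) (eA : encoder A) (eB : encoder B).
Variable st : X -> B -> A -> B.

Let foldst (y : X * (seq A * B)) := foldl (st y.1) y.2.2 y.2.1.

Lemma size_leq_esize (l : seq A) : size l <= esize l.
Proof. by elim: l => // a l IHl; rewrite esize_cons /=; lia. Qed.

Lemma esize_foldl (w : X * A -> nat) c k x l b :
  (forall x b a, esize (st x b a) <= esize b + w (x, a)) ->
  (forall y, w y <= c * esize y ^ k) ->
  esize (foldl (st x) b l) <= esize b + size l * (c * (esize x + esize l) ^ k).
Proof.
move=> stw wc; elim: l b => [|a l IHl] b /=; first by rewrite addn0.
apply: leq_trans (IHl _) _; rewrite mulSn addnA leq_add //.
  apply: leq_trans (stw _ _ _) _; rewrite leq_add2l.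
  apply: leq_trans (wc _) _; rewrite leq_mul2l; apply/orP; right.
  by case: k {wc IHl} => // k; rewrite leq_exp2r // esize_pair esize_cons; lia.
rewrite leq_mul2l leq_mul2l; apply/orP; right; apply/orP; right.
by case: k {wc IHl} => // k; rewrite leq_exp2r // esize_cons; lia.
Qed.

(* The size of the accumulator may only grow additively, or else iteration
   would leave polynomial space. *)
Lemma ptime_foldst (w : X * A -> nat) :
  ptime (fun y : X * (B * A) => st y.1 y.2.1 y.2.2) ->
  polyb esize w ->
  (forall x b a, esize (st x b a) <= esize b + w (x, a)) ->
  ptime foldst.
Proof.
move=> [_ [P [T [[d [l PT]] HP]]]] [c [k wc]] stw.
pose eY : encoder (X * (seq A * B)) := enc_of_prod eX (enc_of_prod (enc_of_seq eA) eB).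
pose cap y := @esize _ eY y * (c * @esize _ eY y ^ k).
pose stepcost y := d * (2 * @esize _ eY y + cap y) ^ l + 30.
have m0 := @esize_gt0 _ eY.
have pcap : polyb esize cap by exists c, k.+1 => y; rewrite /cap expnS; nia.
split.
  apply: (@polyb_le _ _ _ (fun y => esize y + cap y)).
    move=> [x [s b]]; rewrite /foldst /=.
    apply: leq_trans (esize_foldl _ _ _ stw wc) _.
    rewrite leq_add //; first by rewrite !esize_pair; lia.
    rewrite leq_mul ?leq_mul //.
      by apply: leq_trans (size_leq_esize _) _; rewrite !esize_pair; lia.
    by case: (k) => // k'; rewrite leq_exp2r // !esize_pair; lia.
  by apply: polyb_add => //; exact: polyb_id.
(* The top of the stack is the pair of the parameter and the unread part of the list; register 0
   holds the accumulator. *)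
pose loop := While (ESnd (EFst (Var 1)))
   (Seq (Assign 0 (ENode (EFst (EFst (Var 1)))
          (ENode (Var 0) (EFst (ESnd (EFst (Var 1)))))))
   (Seq (Assign 1 (ENode (ENode (EFst (EFst (Var 1))) (ESnd (ESnd (EFst (Var 1)))))
          (ESnd (Var 1)))) P)).
exists (Seq (Assign 1 (ENode (ENode (EFst (Var 0)) (EFst (ESnd (Var 0)))) (Var 1)))
  (Seq (Assign 0 (ESnd (ESnd (Var 0)))) (Seq loop (Assign 1 (ESnd (Var 1)))))),
  (fun y => esize y * stepcost y + 30); split.
  apply: polyb_add => //; last exact: polyb_const.
  apply: polyb_mul; first exact: polyb_id.
  apply: polyb_add => //; last exact: polyb_const.
  apply: (@polyb_comp _ _ _ id (fun z => 2 * esize z + cap z) (fun n => d * n ^ l)).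
    by apply: polyb_add => //; exists 2, 1.
  by exists d, l.
move=> s [x [r b]] sx; set y := (x, (r, b)).
have xy : esize x + esize r + esize b < @esize _ eY y by rewrite /y !esize_pair; lia.
have sr : size r <= @esize _ eY y by move: xy (size_leq_esize r); lia.
(* The last hypothesis is a potential: the size of the accumulator plus all that the unread elements
   may still add stays within a fixed allowance. Hence every call of [P] gets an argument of bounded
   size, and [stepcost y] bounds each round. *)
have loopP : forall r' s0 acc rest,
    s0 0 = code acc -> s0 1 = Node (Node (code x) (code r')) rest ->
    esize r' <= esize r ->
    esize acc + size r' * (c * esize y ^ k) <= esize y + cap y ->
    exists t s', [/\ exec loop s0 t s', s' 0 = code (foldl (st x) acc r'),
      t <= size r' * stepcost y + 4, s' 1 = Node (Node (code x) Leaf) rest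
    & forall z, z != 0 -> z != 1 -> z != 2 -> s' z = s0 z].
  elim=> [|a r' IHr] s0 acc rest v0 v1 rr accS.
    exists 4, s0; split=> //.
    by apply: (@ExecWhileF (ESnd (EFst (Var 1)))); rewrite /= v1.
  set s1 := upd s0 0 (Node (code x) (Node (code acc) (code a))).
  set s2 := upd s1 1 (Node (Node (code x) (code r')) rest).
  have [|t [s3 [e3 v3 l3 k3]]] := HP s2 (x, (acc, a)); first by [].
  have [||||u [s4 [e4 v4 l4 w4 k4]]] := IHr s3 (st x acc a) rest.
  - exact: v3.
  - by rewrite k3.
  - by move: rr; rewrite esize_cons; lia.
  - apply: leq_trans accS; rewrite /= mulSn addnA leq_add2r.
    apply: leq_trans (stw _ _ _) _; rewrite leq_add2l.
    apply: leq_trans (wc _) _; rewrite leq_mul2l; apply/orP; right.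
    case: (k) => // k'; rewrite leq_exp2r // esize_pair.
    by move: rr; rewrite esize_cons; lia.
  exists (4 + ((10 + 1 + (11 + 1 + t)) + u)), s4; split=> //.
  - apply: (@ExecWhileT (ESnd (EFst (Var 1)))); first by rewrite /= v1.
      apply: (@ExecSeq _ _ _ s1).
        have := ExecAssign 0 (ENode (EFst (EFst (Var 1)))
          (ENode (Var 0) (EFst (ESnd (EFst (Var 1)))))) s0.
        by rewrite /= v1 v0.
      apply: (@ExecSeq _ _ _ s2) e3.
      have := ExecAssign 1 (ENode (ENode (EFst (EFst (Var 1)))
          (ESnd (ESnd (EFst (Var 1))))) (ESnd (Var 1))) s1.
      by rewrite /= /s1 /upd /= v1.
    exact: e4.
  - suff : t + 30 <= stepcost y by rewrite [size _]/= mulSn; move: l4; lia.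
    rewrite leq_add2r.
    apply: leq_trans l3 _; apply: leq_trans (PT _) _.
    rewrite leq_mul2l; apply/orP; right.
    case: (l) => // l'; rewrite leq_exp2r // 2!esize_pair.
    have := leq_trans (leq_addr _ _) accS; have := @esize_gt0 _ (enc_of_seq eA) r'.
    by move: rr xy; rewrite esize_cons; lia.
  - move=> z z0 z1 z2; rewrite k4 // k3 // /s2 /s1 /upd.
    by rewrite (negPf z0) (negPf z1).
set s1 := upd s 1 (Node (Node (code x) (code r)) (s 1)).
set s2 := upd s1 0 (code b).
have [||||t [s3 [e3 v3 l3 w3 k3]]] := loopP r s2 b (s 1).
- by [].
- by [].
- by [].
- rewrite leq_add //; first by move: xy; lia.
  by rewrite leq_mul.
exists (8 + 1 + (3 + 1 + (t + 3))), (upd s3 1 (s 1)); split.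
- apply: (@ExecSeq _ _ _ s1).
    have := ExecAssign 1 (ENode (ENode (EFst (Var 0)) (EFst (ESnd (Var 0))))
      (Var 1)) s.
    by rewrite /= sx.
  apply: (@ExecSeq _ _ _ s2).
    have := ExecAssign 0 (ESnd (ESnd (Var 0))) s1.
    by rewrite /= /s1 /upd /= sx.
  apply: ExecSeq e3 _.
  have := ExecAssign 1 (ESnd (Var 1)) s3.
  by rewrite /= w3.
- by rewrite /upd /=.
- apply: (@leq_trans (size r * stepcost y + 30)); first by move: l3; lia.
  by rewrite leq_add2r leq_mul.
- move=> z z0 z2; rewrite /upd; have [->//|z1] := eqVneq z 1.
  by rewrite k3 // /s2 /s1 /upd (negPf z0) (negPf z1).
Qed.

Lemma ptime_foldl (f : X -> B) (g : X -> seq A) (w : X * A -> nat) :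
  ptime f -> ptime g ->
  ptime (fun y : X * (B * A) => st y.1 y.2.1 y.2.2) ->
  polyb esize w ->
  (forall x b a, esize (st x b a) <= esize b + w (x, a)) ->
  ptime (fun x => foldl (st x) (f x) (g x)).
Proof.
move=> pf pg pst pw stw.
apply: (@ptime_comp _ _ _ _ _ _ (fun x => (x, (g x, f x))) _ _ (ptime_foldst pst pw stw)).
by apply: ptime_pair; [exact: ptime_id | exact: ptime_pair].
Qed.

End Fold.

Section Derived.
Variables (X : Type) (eX : encoder X).

Lemma ptime_cons A (eA : encoder A) (f : X -> A) (g : X -> seq A) :
  ptime f -> ptime g -> ptime (fun x => f x :: g x).
Proof.
move=> pf pg.
exact: (@ptime_recode _ _ _ _ _ _ (fun x => (f x, g x))
  (fun y : A * seq A => y.1 :: y.2) _ (ptime_pair pf pg)).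
Qed.

Lemma ptime_behead A (eA : encoder A) (f : X -> seq A) :
  ptime f -> ptime (fun x => behead (f x)).
Proof.
move=> pf; apply: (ptime_comp pf (g := behead)).
apply: (@ptime_expr _ _ _ _ _ (ESnd (Var 0))) => [|s [|a l] /= ->//].
by apply: (polyb_le _ (polyb_id _)) => -[|a l] //; rewrite esize_cons /=; lia.
Qed.

(** The default has to be coded by [Leaf], the value of [EFst] on [Leaf]; the empty list is. *)
Lemma ptime_head A (eA : encoder A) (f : X -> seq (seq A)) :
  ptime f -> ptime (fun x => head [::] (f x)).
Proof.
move=> pf; apply: (ptime_comp pf (g := head [::])).
apply: (@ptime_expr _ _ _ _ _ (EFst (Var 0))) => [|s [|a l] /= ->//].
by apply: (polyb_le _ (polyb_id _)) => -[|a l] //; rewrite esize_cons /=; lia.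
Qed.

Lemma ptime_S (f : X -> nat) : ptime f -> ptime (fun x => (f x).+1).
Proof.
move=> pf; apply: (@ptime_recode _ _ _ _ _ _ (fun x => (tt, f x)) (fun y => y.2.+1)) => //.
by apply: (ptime_pair _ pf); exact: (ptime_const _ _ tt).
Qed.

Lemma ptime_pred (f : X -> nat) : ptime f -> ptime (fun x => (f x).-1).
Proof.
move=> pf; apply: (ptime_comp pf (g := predn)).
apply: (@ptime_expr _ _ _ _ _ (ESnd (Var 0))) => [|s [|n] /= ->//].
by apply: (polyb_le _ (polyb_id _)) => n; rewrite !esize_nat; lia.
Qed.

(** A unary number is already coded as a list of units, so iteration becomes a fold. *)
Lemma ptime_unary (f : X -> nat) : ptime f -> ptime (fun x => nseq (f x) tt).
Proof.
apply: (@ptime_recode _ _ _ _ _ _ f (fun n => nseq n tt)).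
by rewrite /code; elim=> //= n ->.
Qed.

End Derived.

Section Loops.
Variables (X : Type) (eX : encoder X).

Lemma ptime_iter A (eA : encoder A) (st : X -> A -> A) (f : X -> A)
    (n w : X -> nat) :
  ptime f -> ptime n -> ptime (fun y : X * A => st y.1 y.2) ->
  polyb esize w -> (forall x a, esize (st x a) <= esize a + w x) ->
  ptime (fun x => iter (n x) (st x) (f x)).
Proof.
move=> pf pn pst pw stw.
apply: (@ptime_ext _ _ _ _ (fun x => foldl (fun a _ => st x a) (f x) (nseq (n x) tt))).
  by move=> x; elim: (n x) (f x) => // k IHk a /=; rewrite IHk -iterSr.
apply: (@ptime_foldl _ _ _ _ _ _ (fun x a _ => st x a) _ _ (fun y => w y.1)).
- exact: pf.
- exact: ptime_unary.
- apply: (@ptime_comp _ _ _ _ _ _ (fun y : X * (A * unit) => (y.1, y.2.1)) _ _ pst).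
  by apply: ptime_pair; [|apply: ptime_fst; apply: ptime_snd];
    [apply: ptime_fst|]; exact: ptime_id.
- apply: (polyb_comp (f := fst) _ pw).
  by apply: (polyb_le _ (polyb_id _)) => -[x []]; rewrite esize_pair /=; lia.
- by move=> x b a; exact: stw.
Qed.

Lemma ptime_andb (f g : X -> bool) :
  ptime f -> ptime g -> ptime (fun x => f x && g x).
Proof. by move=> pf pg; apply: ptime_if => //; exact: ptime_const. Qed.

Lemma ptime_orb (f g : X -> bool) :
  ptime f -> ptime g -> ptime (fun x => f x || g x).
Proof. by move=> pf pg; apply: ptime_if => //; exact: ptime_const. Qed.

Lemma ptime_negb (f : X -> bool) : ptime f -> ptime (fun x => ~~ f x).
Proof. by move=> pf; apply: ptime_if => //; exact: ptime_const. Qed.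

Lemma ptime_eqb (f g : X -> bool) :
  ptime f -> ptime g -> ptime (fun x => f x == g x).
Proof.
move=> pf pg; apply: (@ptime_ext _ _ _ _ (fun x => if f x then g x else ~~ g x)).
  by move=> x; case: (f x); case: (g x).
by apply: ptime_if => //; exact: ptime_negb.
Qed.

End Loops.

(** * Arithmetic on unary numbers *)

Section Subtraction.
Variables (X : Type) (eX : encoder X).

Lemma ptime_eq0 (f : X -> nat) : ptime f -> ptime (fun x => f x == 0).
Proof.
move=> pf; apply: (@ptime_ext _ _ _ _ (fun x => iter (f x) (fun=> false) true)).
  by move=> x; case: (f x).
apply: (@ptime_iter _ _ _ _ (fun _ _ => false) _ _ (fun=> 0)) => //.
- exact: ptime_const.
- exact: ptime_const.
- exact: polyb_const.
- by move=> x a; rewrite addn0; case: a.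
Qed.

Lemma ptime_addn (f g : X -> nat) :
  ptime f -> ptime g -> ptime (fun x => f x + g x).
Proof.
move=> pf pg; apply: (@ptime_ext _ _ _ _ (fun x => iter (f x) succn (g x))).
  by move=> x; elim: (f x) => //= n ->; rewrite addSn.
apply: (@ptime_iter _ _ _ _ (fun _ => succn) _ _ (fun=> 2)) => //.
- exact: (ptime_S (ptime_snd (ptime_id _))).
- exact: polyb_const.
- by move=> x a; rewrite !esize_nat; lia.
Qed.

Lemma ptime_subn (f g : X -> nat) :
  ptime f -> ptime g -> ptime (fun x => f x - g x).
Proof.
move=> pf pg; apply: (@ptime_ext _ _ _ _ (fun x => iter (g x) predn (f x))).
  by move=> x; elim: (g x) => [|n /= ->]; rewrite ?subn0 ?subnS.
apply: (@ptime_iter _ _ _ _ (fun _ => predn) _ _ (fun=> 0)) => //.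
- exact: (ptime_pred (ptime_snd (ptime_id _))).
- exact: polyb_const.
- by move=> x a; rewrite !esize_nat; lia.
Qed.

End Subtraction.

Section Arith.
Variables (X : Type) (eX : encoder X).

Lemma polyb_ptime (f : X -> nat) : ptime f -> polyb esize f.
Proof. by move=> [pf _]; apply: polyb_le pf => x; rewrite esize_nat; lia. Qed.

Lemma ptime_leq (f g : X -> nat) :
  ptime f -> ptime g -> ptime (fun x => f x <= g x).
Proof. by move=> pf pg; apply: ptime_eq0; exact: ptime_subn. Qed.

Lemma ptime_eqn (f g : X -> nat) :
  ptime f -> ptime g -> ptime (fun x => f x == g x).
Proof.
move=> pf pg; apply: (@ptime_ext _ _ _ _ (fun x => (f x <= g x) && (g x <= f x))).
  by move=> x; rewrite eqn_leq.
by apply: ptime_andb; exact: ptime_leq.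
Qed.

End Arith.

Section Division.
Variables (X : Type) (eX : encoder X).

Lemma ptime_muln (f g : X -> nat) :
  ptime f -> ptime g -> ptime (fun x => f x * g x).
Proof.
move=> pf pg; apply: (@ptime_ext _ _ _ _ (fun x => iter (f x) (addn (g x)) 0)).
  by move=> x; elim: (f x) => //= n ->; rewrite mulSn.
apply: (@ptime_iter _ _ _ _ (fun x => addn (g x)) _ _ (fun x => 2 * g x)) => //.
- exact: ptime_const.
- apply: ptime_addn; last by apply: ptime_snd; exact: ptime_id.
  by apply: (@ptime_comp _ _ _ _ _ _ fst g) => //; apply: ptime_fst; exact: ptime_id.
- apply: polyb_mul; first exact: polyb_const.
  exact: polyb_ptime.
- by move=> x a; rewrite !esize_nat; lia.
Qed.

Definition divmod_step d (y : nat * nat) :=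
  if y.2.+1 == d then (y.1.+1, 0) else (y.1, y.2.+1).

Lemma iter_divmod_step d n : 0 < d ->
  iter n (divmod_step d) (0, 0) = (n %/ d, n %% d).
Proof.
move=> d0; elim: n => [|n IHn]; first by rewrite div0n mod0n.
rewrite iterS IHn /divmod_step /= divnS // modnS.
rewrite {1 2}[n in d %| n.+1](divn_eq n d) -addnS dvdn_addr ?dvdn_mull //.
have := ltn_pmod n d0; rewrite leq_eqVlt => /orP[/eqP->|lt].
  by rewrite dvdnn eqxx add1n.
by rewrite (ltn_eqF lt) gtnNdvd // add0n.
Qed.

Lemma ptime_divmod (f g : X -> nat) : (forall x, 0 < g x) ->
  ptime f -> ptime g -> ptime (fun x => (f x %/ g x, f x %% g x)).
Proof.
move=> g0 pf pg.
apply: (@ptime_ext _ _ _ _ (fun x => iter (f x) (divmod_step (g x)) (0, 0))).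
  by move=> x; rewrite iter_divmod_step.
apply: (@ptime_iter _ _ _ _ (fun x => divmod_step (g x)) _ _ (fun x => 4)) => //.
- exact: ptime_const.
- have p2 : @ptime (X * (nat * nat)) _ _ _ snd by apply: ptime_snd; exact: ptime_id.
  apply: ptime_if; last 2 first.
  + apply: ptime_pair; last exact: ptime_const.
    by apply: ptime_S; exact: ptime_fst.
  + apply: ptime_pair; first exact: ptime_fst.
    by apply: ptime_S; exact: ptime_snd.
  apply: ptime_eqn; first by apply: ptime_S; exact: ptime_snd.
  by apply: (@ptime_comp _ _ _ _ _ _ fst g) => //; apply: ptime_fst; exact: ptime_id.
- exact: polyb_const.
- move=> x [q r]; rewrite /divmod_step /=.
  by case: ifP => _; rewrite !esize_pair !esize_nat; lia.
Qed.

Lemma ptime_divn (f g : X -> nat) : (forall x, 0 < g x) ->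
  ptime f -> ptime g -> ptime (fun x => f x %/ g x).
Proof. by move=> g0 pf pg; exact: (ptime_fst (ptime_divmod g0 pf pg)). Qed.

Lemma ptime_modn (f g : X -> nat) : (forall x, 0 < g x) ->
  ptime f -> ptime g -> ptime (fun x => f x %% g x).
Proof. by move=> g0 pf pg; exact: (ptime_snd (ptime_divmod g0 pf pg)). Qed.

Lemma ptime_half (f : X -> nat) : ptime f -> ptime (fun x => (f x)./2).
Proof.
move=> pf; apply: (@ptime_ext _ _ _ _ (fun x => f x %/ 2)).
  by move=> x; rewrite divn2.
by apply: ptime_divn => //; exact: ptime_const.
Qed.

End Division.

(** * List operations *)

Section Lists.
Variables (X : Type) (eX : encoder X).

Lemma ptime_foldl_cons A B (eA : encoder A) (eB : encoder B)
    (f : X -> seq B) (g : X -> seq A) (h : X -> A -> B) :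
  ptime f -> ptime g -> ptime (fun y : X * A => h y.1 y.2) ->
  ptime (fun x => foldl (fun r a => h x a :: r) (f x) (g x)).
Proof.
move=> pf pg ph.
have ph' : ptime (fun y : X * (seq B * A) => h y.1 y.2.2).
  apply: (@ptime_comp _ _ _ _ _ _ (fun y : X * (seq B * A) => (y.1, y.2.2)) _ _ ph).
  by apply: ptime_pair; [|apply: ptime_snd]; [apply: ptime_fst | apply: ptime_snd];
    exact: ptime_id.
apply: (@ptime_foldl _ _ _ _ _ _ (fun x r a => h x a :: r) _ _
          (fun y => (esize (h y.1 y.2)).+1)) => //.
- apply: (@ptime_cons (X * (seq B * A))) => //.
  by apply: ptime_fst; apply: ptime_snd; exact: ptime_id.
- case: ph => sh _; apply: (polyb_le (g := fun y => esize (h y.1 y.2) + 1)).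
    by move=> y; rewrite addn1.
  by apply: polyb_add; [exact: esize_gt0 | | exact: polyb_const].
- by move=> x b a; rewrite esize_cons /=; lia.
Qed.

Lemma ptime_catrev A (eA : encoder A) (f g : X -> seq A) :
  ptime f -> ptime g -> ptime (fun x => catrev (f x) (g x)).
Proof.
move=> pf pg.
apply: (@ptime_ext _ _ _ _ (fun x => foldl (fun r a => a :: r) (g x) (f x))).
  by move=> x; elim: (f x) (g x) => //= a l IHl r; rewrite IHl.
apply: (@ptime_foldl_cons _ _ _ _ _ _ (fun _ a => a)) => //.
by apply: (@ptime_snd (X * A)); exact: ptime_id.
Qed.

Lemma ptime_rev A (eA : encoder A) (f : X -> seq A) :
  ptime f -> ptime (fun x => rev (f x)).
Proof. by move=> pf; apply: ptime_catrev => //; exact: ptime_const. Qed.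

Lemma ptime_map A B (eA : encoder A) (eB : encoder B)
    (g : X -> seq A) (h : X -> A -> B) :
  ptime g -> ptime (fun y : X * A => h y.1 y.2) ->
  ptime (fun x => map (h x) (g x)).
Proof.
move=> pg ph.
apply: (@ptime_ext _ _ _ _ (fun x => rev (foldl (fun r a => h x a :: r) [::] (g x)))).
  move=> x; rewrite -[RHS]revK; congr rev.
  elim/last_ind: (g x) => // s a IHs.
  by rewrite -cats1 foldl_cat /= IHs map_cat rev_cat.
by apply: ptime_rev; apply: ptime_foldl_cons => //; exact: ptime_const.
Qed.

End Lists.

Section MoreLists.
Variables (X : Type) (eX : encoder X).

Lemma esize_catrev A (eA : encoder A) (s r : seq A) :
  esize (catrev s r) = esize r + (esize s).-1.
Proof.
elim: s r => [|a s IHs] r; first by rewrite /= addn0.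
by rewrite [catrev _ _]/= IHs !esize_cons [_.+1.-1]/=; have := @esize_gt0 _ (enc_of_seq eA) s; lia.
Qed.

Lemma ptime_flatten A (eA : encoder A) (f : X -> seq (seq A)) :
  ptime f -> ptime (fun x => flatten (f x)).
Proof.
move=> pf.
apply: (@ptime_ext _ _ _ _
  (fun x => rev (foldl (fun r l => catrev l r) [::] (f x)))).
  move=> x; rewrite -[RHS]revK; congr rev.
  elim/last_ind: (f x) => // s a IHs.
  by rewrite -cats1 foldl_cat /= IHs flatten_cat rev_cat /= cats0 catrevE.
apply: ptime_rev; apply: (@ptime_foldl _ _ _ _ _ _ (fun _ r l => catrev l r) _ _
   (fun y => esize y)) => //.
- exact: ptime_const.
- have p2 : ptime (fun y : X * (seq A * seq A) => y.2).
    by apply: ptime_snd; exact: ptime_id.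
  by apply: ptime_catrev; [exact: ptime_snd | exact: ptime_fst].
- exact: polyb_id.
- move=> x b a; rewrite esize_pair.
  by rewrite esize_catrev; lia.
Qed.

(* The test only serves to make the size increase bounded. *)
Definition iota_step n (y : nat * seq nat) :=
  (y.1.+1, (if y.1 <= n then y.1 else 0) :: y.2).

Lemma ptime_iota0 (f : X -> nat) : ptime f -> ptime (fun x => iota 0 (f x)).
Proof.
move=> pf; apply: (@ptime_ext _ _ _ _
  (fun x => rev (iter (f x) (iota_step (f x)) (0, [::])).2)).
  move=> x; rewrite -[RHS]revK; congr rev; set n := f x.
  suff iterE k : k <= n -> iter k (iota_step n) (0, [::]) = (k, rev (iota 0 k)).
    by rewrite iterE.
  elim: k => // k IHk kn; rewrite iterS IHk ?(ltnW kn) // -addn1 iotaD rev_cat.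
  by rewrite /iota_step /= (ltnW kn) addn1.
apply: ptime_rev; apply: ptime_snd.
apply: (@ptime_iter _ _ _ _ (fun x => iota_step (f x)) _ _ (fun x => 2 * f x + 5)).
- exact: ptime_const.
- exact: pf.
- have p2 : @ptime (X * (nat * seq nat)) _ _ _ snd by apply: ptime_snd; exact: ptime_id.
  apply: ptime_pair; first by apply: ptime_S; exact: ptime_fst.
  apply: ptime_cons; last exact: ptime_snd.
  apply: ptime_if; [|exact: ptime_fst|exact: ptime_const].
  apply: ptime_leq; first exact: ptime_fst.
  by apply: (@ptime_comp _ _ _ _ _ _ fst f) => //; apply: ptime_fst; exact: ptime_id.
- apply: polyb_add; [exact: esize_gt0 | | exact: polyb_const].
  apply: polyb_mul; first exact: polyb_const.
  exact: polyb_ptime.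
- move=> x [k r]; rewrite /iota_step !esize_pair esize_cons !esize_nat /=.
  by case: ifP; lia.
Qed.

Lemma ptime_has A (eA : encoder A) (f : X -> seq A) (h : X -> A -> bool) :
  ptime f -> ptime (fun y : X * A => h y.1 y.2) ->
  ptime (fun x => has (h x) (f x)).
Proof.
move=> pf ph.
apply: (@ptime_ext _ _ _ _ (fun x => foldl (fun b a => b || h x a) false (f x))).
  move=> x; elim: (f x) => //= a l IHl; rewrite -{}IHl.
  by case: (h x a) => //; elim: l.
apply: (@ptime_foldl _ _ _ _ _ _ (fun x b a => b || h x a) _ _ (fun=> 3)).
- exact: ptime_const.
- exact: pf.
- have p2 : ptime (fun y : X * (bool * A) => y.2).
    by apply: ptime_snd; exact: ptime_id.
  apply: ptime_orb; first exact: ptime_fst.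
  apply: (@ptime_comp _ _ _ _ _ _ (fun y : X * (bool * A) => (y.1, y.2.2)) _ _ ph).
  by apply: ptime_pair; [apply: ptime_fst; exact: ptime_id | exact: ptime_snd].
- exact: polyb_const.
- by move=> x b a; rewrite (leq_trans (esize_bool _)) // leq_addl.
Qed.

Lemma ptime_nth A (eA : encoder A) (f : X -> seq (seq A)) (k : X -> nat) :
  ptime f -> ptime k -> ptime (fun x => nth [::] (f x) (k x)).
Proof.
move=> pf pk.
apply: (@ptime_ext _ _ _ _ (fun x => head [::] (iter (k x) behead (f x)))).
  move=> x; elim: (k x) (f x) => [|i IHi] l; first by case: l.
  by rewrite iterSr IHi; case: l => //=; rewrite !nth_nil.
apply: ptime_head.
apply: (@ptime_iter _ _ _ _ (fun _ => behead) _ _ (fun=> 0)) => //.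
- exact: (ptime_behead (ptime_snd (ptime_id _))).
- exact: polyb_const.
- by move=> x [|a l] //; rewrite esize_cons /=; lia.
Qed.

Lemma ptime_size A (eA : encoder A) (f : X -> seq A) :
  ptime f -> ptime (fun x => size (f x)).
Proof.
move=> pf.
apply: (@ptime_ext _ _ _ _ (fun x => foldl (fun n _ => n.+1) 0 (f x))).
  move=> x; rewrite -[RHS]add0n; elim: (f x) 0 => [|a l IHl] n; first by rewrite addn0.
  by rewrite /= IHl addnS.
apply: (@ptime_foldl _ _ _ _ _ _ (fun _ n _ => n.+1) _ _ (fun=> 2)) => //.
- exact: ptime_const.
- exact: (ptime_S (ptime_fst (ptime_snd (ptime_id _)))).
- exact: polyb_const.
- by move=> x n a; rewrite !esize_nat; lia.
Qed.

End MoreLists.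

(** Once register 2 is cleared, the store left by the program for [f] is exactly an initial store
    with input [f x], so [P] can follow unchanged. *)
Lemma ptime_then (A B : Type) (eA : encoder A) (eB : encoder B) (f : A -> B) P :
  ptime f -> exists Q c k, forall x t s,
    exec P (upd (fun=> Leaf) 0 (code (f x))) t s ->
    exists2 t', exec Q (upd (fun=> Leaf) 0 (code x)) t' s
              & t' <= t + c * esize x ^ k.
Proof.
move=> [_ [F [T [pT FP]]]].
have [c [k H]] : polyb esize (fun x => T x + 2).
  by apply: polyb_add; [exact: esize_gt0 | | exact: polyb_const].
exists (Seq F (Seq (Assign 2 ELeaf) P)), c, k => x t s eP.
have [|u [s1 [e1 v1 l1 k1]]] := FP (upd (fun=> Leaf) 0 (code x)) x; first by [].
exists (u + (2 + t)); last by have := H x; lia.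
apply: ExecSeq e1 _; apply: ExecSeq (ExecAssign _ _ _) _.
suff -> : upd s1 2 (eval s1 ELeaf) = upd (fun=> Leaf) 0 (@code _ eB (f x)) by [].
apply: boolp.funext => y; rewrite /upd; case: eqP => [->//|/eqP y2].
by case: eqP => [->//|/eqP y0]; rewrite k1 // /upd (negPf y0).
Qed.

(** * Path decompositions and labelled graphs *)

Section Clique.
Variables (G : sgraph) (D : seq {set 'I_(nverts G)}).
Hypothesis pdD : path_decomp D.

Let first v := find (fun B : {set 'I_(nverts G)} => v \in B) D.

Let firstP v : v \in nth set0 D (first v).
Proof.
have [B BD vB] := pd_vertex pdD v.
by apply: (nth_find set0 (a := fun B : {set _} => v \in B)); apply/hasP; exists B.
Qed.

(* Helly property: the latest first bag of a clique vertex contains the clique. *)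
Lemma clique_in_bag (K : {set 'I_(nverts G)}) :
  0 < #|K| -> {in K &, forall u v, u != v -> adj u v} ->
  exists2 B, B \in D & K \subset B.
Proof.
move=> /card_gt0P[v0 v0K] Kadj; pose v := [arg max_(v > v0 in K) first v].
have [vK vmax] : v \in K /\ forall u, u \in K -> first u <= first v.
  by rewrite /v; case: arg_maxnP.
have fD u : first u < size D.
  by have [B BD uB] := pd_vertex pdD u; rewrite -has_find; apply/hasP; exists B.
exists (nth set0 D (first v)); first exact: mem_nth.
apply/fintype.subsetP => u uK; have [->|uv] := eqVneq u v; first exact: firstP.
have [B BD /andP[uB vB]] := pd_edge pdD (Kadj _ _ uK vK uv).
have iB : index B D < size D by rewrite index_mem.
have uj : u \in nth set0 D (index B D) by rewrite nth_index.
have le : first v <= index B D.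
  by rewrite leqNgt; apply/negP => /(before_find set0); rewrite nth_index // vB.
apply: (fintype.subsetP (pd_interval pdD (vmax u uK) le iB)).
by rewrite inE firstP uj.
Qed.

Lemma width_ge_clique (K : {set 'I_(nverts G)}) :
  {in K &, forall u v, u != v -> adj u v} -> #|K|.-1 <= width D.
Proof.
move=> Kadj; case: (posnP #|K|) => [->//|K0].
have [B BD KB] := clique_in_bag K0 Kadj.
rewrite /width -!subn1 leq_sub2r // (leq_trans (subset_leq_card KB)) //.
exact: (@leq_bigmax_seq _ _ xpredT (fun B : {set _} => #|B|)).
Qed.

End Clique.

Lemma pathwidth_clique (G : sgraph) (D : seq {set 'I_(nverts G)})
    (K : {set 'I_(nverts G)}) :
  path_decomp D -> {in K &, forall u v, u != v -> adj u v} ->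
  width D <= #|K|.-1 -> pathwidth G = #|K|.-1 /\ width D = pathwidth G.
Proof.
move=> pdD Kadj wD; have wK := width_ge_clique pdD Kadj.
suff -> : pathwidth G = #|K|.-1 by split=> //; apply/eqP; rewrite eqn_leq wD.
rewrite /pathwidth; case: ex_minnP => w /boolp.asboolP[D' pdD' wD'] wmin.
apply/eqP; rewrite eqn_leq (leq_trans (width_ge_clique pdD' Kadj) wD') andbT.
by apply: wmin; apply/boolp.asboolP; exists D.
Qed.

Section LabelledGraph.
Variables (T : eqType) (d : T) (V : seq T) (e : rel T).
Hypotheses (e_sym : symmetric e) (e_irr : irreflexive e) (V_uniq : uniq V).

Let lab (i : 'I_(size V)) := nth d V i.

Let lab_mem i : lab i \in V. Proof. exact: mem_nth. Qed.

Let lab_inj : injective lab.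
Proof. by move=> i j /eqP; rewrite nth_uniq // => /eqP/val_inj. Qed.

Let labP v : v \in V -> exists i, lab i = v.
Proof.
move=> vV; have iV : index v V < size V by rewrite index_mem.
by exists (Ordinal iV); rewrite /lab nth_index.
Qed.

(** The position in [V] is the vertex number. Characteristic vectors and adjacency matrices thereby
    become maps over [V], in a form that a polynomial-time function can produce. *)
Definition label_graph : sgraph :=
  @SGraph (size V) (fun i j => e (lab i) (lab j))
    (fun i j => e_sym (lab i) (lab j)) (fun i => e_irr (lab i)).

Lemma map_lab (B : Type) (f : T -> B) : [seq f (lab i) | i <- enum 'I_(size V)] = map f V.
Proof.
rewrite -[in RHS](mkseq_nth d V) /mkseq -val_enum_ord -!map_comp.
exact: eq_map.
Qed.

Lemma sum_lab (x : pred T) : \sum_(v <- V) x v = #|[set i | x (lab i)]|.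
Proof.
rewrite (big_nth d) big_mkord -sum1_card big_mkcond [RHS]big_mkcond /=.
by apply: eq_bigr => i _; rewrite inE; case: (x _).
Qed.

Lemma has_tds_labelP b :
  reflect (exists2 x : pred T, \sum_(v <- V) x v <= b &
             {in V, forall v, exists2 u, u \in V & x u && e u v})
    (has_tds label_graph b).
Proof.
apply: (iffP existsP) => [[X /andP[Xb /eqP domX]]|[x xb domx]].
- pose x v := [exists i in X, lab i == v].
  have xE i : x (lab i) = (i \in X).
    apply/exists_inP/idP => [[j jX /eqP/lab_inj <-//]|iX].
    by exists i.
  exists x.
    rewrite sum_lab; apply: leq_trans Xb; apply: subset_leq_card.
    by apply/fintype.subsetP => i; rewrite inE xE.
  move=> v /labP[i <-]; have : i \in [set: 'I_(size V)] by rewrite inE.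
  rewrite -domX => /bigcupP[j jX]; rewrite inE /= => eji.
  by exists (lab j); rewrite ?xE ?jX.
- exists [set i | x (lab i)]; rewrite -sum_lab xb /=.
  apply/eqP/setP => i; rewrite inE; apply/bigcupP.
  have [_ /labP[j <-] /andP[xj eji]] := domx _ (lab_mem i).
  by exists j; rewrite inE.
Qed.

Lemma enc_set_lab (p : pred T) :
  enc_set [set i : 'I_(size V) | p (lab i)] = enc_list enc_bool (map p V).
Proof.
rewrite /enc_set -map_lab; congr enc_list.
by apply: eq_map => i; rewrite inE.
Qed.

Lemma enc_label_graph :
  enc_graph label_graph =
  enc_list (enc_list enc_bool) [seq [seq e u v | v <- V] | u <- V].
Proof.
rewrite /enc_graph -(map_lab (fun u => [seq e u v | v <- V])).
elim: (enum _) => //= i s ->; congr Node.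
exact: (enc_set_lab (e (lab i))).
Qed.

Variables (S : eqType) (q0 : S) (Q : seq S) (bag : S -> pred T).

Definition label_bags : seq {set 'I_(size V)} :=
  [seq [set i | bag q (lab i)] | q <- Q].

Lemma label_bags_decomp :
  {in V, forall v, exists2 q, q \in Q & bag q v} ->
  {in V &, forall u v, e u v -> exists2 q, q \in Q & bag q u && bag q v} ->
  (forall i j k v, v \in V -> i <= j -> j <= k -> k < size Q ->
     bag (nth q0 Q i) v -> bag (nth q0 Q k) v -> bag (nth q0 Q j) v) ->
  @path_decomp label_graph label_bags.
Proof.
move=> bagV bagE bagI; split.
- move=> i; have [q qQ bq] := bagV _ (lab_mem i).
  by exists [set i | bag q (lab i)]; rewrite ?inE // map_f.
- move=> i j /(bagE _ _ (lab_mem i) (lab_mem j))[q qQ bq].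
  by exists [set i | bag q (lab i)]; rewrite ?inE // map_f.
- move=> i j k ij jk; rewrite size_map => kQ.
  have [iQ jQ] : i < size Q /\ j < size Q by lia.
  rewrite !(nth_map q0) //; apply/fintype.subsetP => l; rewrite !inE.
  by case/andP; apply: bagI.
Qed.

Lemma width_label_bags w : {in Q, forall q, count (bag q) V <= w.+1} ->
  @width label_graph label_bags <= w.
Proof.
move=> bagw; rewrite /width -subn1 leq_subLR add1n.
rewrite big_map; apply/bigmax_leqP_seq => q qQ _.
apply: leq_trans (bagw q qQ); rewrite -sum_lab.
by rewrite -sum1_count [leqRHS]big_mkcond leq_sum // => v _; case: (bag q v).
Qed.

End LabelledGraph.

(** * The graph of a CNF formula *)

(** Variables are plain numbers, so that the formulas for all [n] share one type, on which the
    reduction is a single function. *)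
Definition raw_clause : Type := seq (nat * bool).
Definition raw_cnf : Type := nat * seq raw_clause.
Definition label : Type := (nat * nat)%type.

(** The additional row takes the last variable when their number is odd, and keeps the divisor
    positive when there are none. *)
Definition rows (x : raw_cnf) : nat := x.1./2.+1.
(** There are [2 * rows x] bits, each changing at most once; one more copy of the formula
    suffices. *)
Definition columns (x : raw_cnf) : nat := size x.2 * (2 * rows x).+1.
Definition cells (x : raw_cnf) : nat := columns x * rows x.

Arguments rows : simpl never.

(* Successor of the predecessor: a positive modulus even for the empty formula. *)
Definition clause_of (x : raw_cnf) (j : nat) : raw_clause :=
  nth [::] x.2 (j %% (size x.2).-1.+1).

Definition lit_of (x : raw_cnf) (v : label) : nat * bool :=
  ((v.2 %% rows x) * 2 + (1 < v.1), (v.1 == 0) || (v.1 == 2)).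

(** The hub [(8, 0)] dominates what is to impose no condition: types 1 to 3, type 0 in the first
    column, with nothing to its left, and type 6 in the last, with nothing to its right. The other
    vertices of types 0 and 6 depend on the grid, and this relates consecutive columns. *)
Definition hub_edge (x : raw_cnf) (v : label) : bool :=
  [|| (v.1 == 0) && (v.2 < rows x),
      (0 < v.1) && (v.1 <= 3)
    | (v.1 == 6) && (cells x <= v.2 + rows x)].

(* A label [(t, k)] with [t <= 6] belongs to cell [k], which lies in column
   [k %/ rows] and row [k %% rows].  Types 0, 1 are "first variable of the row is
   true/false", types 2, 3 the same for the second variable, 4 and 5 have these
   pairs as their neighbourhoods, 6 propagates type 0 to the next column.
   [(7, j)] is the clause of column [j], type 8 is a clique whose members 0, 1
   are forced into the dominating set by the leaves of type 9. *)
Definition edge (x : raw_cnf) (u v : label) : bool :=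
  [|| [&& u.1 == 0, v.1 == 2 & u.2 == v.2],
      [&& u.1 == 3, v.1 == 0 & v.2 == u.2 + rows x],
      [&& u.1 == 4, (v.1 == 2) || (v.1 == 3) & u.2 == v.2],
      [&& u.1 == 5, v.1 <= 1 & u.2 == v.2],
      [&& u.1 == 6, v.1 == 1 & u.2 == v.2],
      [&& u.1 == 6, v.1 == 0 & v.2 == u.2 + rows x],
      [&& u.1 == 7, v.1 <= 3, v.2 %/ rows x == u.2
        & lit_of x v \in clause_of x u.2],
      [&& u.1 == 8, u.2 == 0 & hub_edge x v],
      [&& u.1 == 8, v.1 == 8 & u.2 != v.2]
    | [&& u.1 == 9, v.1 == 8 & u.2 == v.2]].

Definition sedge (x : raw_cnf) (u v : label) : bool := edge x u v || edge x v u.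

(** The clique is as large as the bag of a cell can be: [rows x + 1] vertices of type 0, six of
    types 1 to 6, one clause, two clique vertices and two leaves, [rows x + 12] in all. *)
Definition type_size (x : raw_cnf) (t : nat) : nat :=
  if t <= 6 then cells x else if t == 7 then columns x
  else if t == 8 then rows x + 12 else 2.

Definition labels (x : raw_cnf) : seq label :=
  flatten [seq [seq (t, k) | k <- iota 0 (type_size x t)] | t <- iota 0 10].

Definition budget (x : raw_cnf) : nat := 2 * cells x + 2.

(* Bag 0 is the clique, bag [k.+1] belongs to cell [k]. *)
Definition bag (x : raw_cnf) (q : nat) (v : label) : bool :=
  if q == 0 then v.1 == 8 else
  [|| [&& v.1 == 0, q.-1 <= v.2 & v.2 <= q.-1 + rows x],
      [&& 0 < v.1, v.1 <= 6 & v.2 == q.-1],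
      (v.1 == 7) && (v.2 == q.-1 %/ rows x),
      (v.1 == 8) && (v.2 <= 1)
    | v.1 == 9].

(** One bag beyond the last cell: without clauses there is no cell, but the leaves of type 9 still
    need a bag. *)
Definition bag_indices (x : raw_cnf) : seq nat := iota 0 (cells x).+2.

Section Labels.
Variable x : raw_cnf.
Local Notation R := (rows x).
Local Notation M := (cells x).
Local Notation L := (columns x).
Local Notation V := (labels x).

Lemma mem_labels t k : ((t, k) \in V) = (t < 10) && (k < type_size x t).
Proof.
apply/flatten_mapP/andP => [[t' tt' /mapP[k' kk' [-> ->]]]|[t10 kt]].
  by move: tt' kk'; rewrite !mem_iota.
by exists t; rewrite ?mem_iota //; apply: map_f; rewrite mem_iota.
Qed.

Lemma labels_uniq : uniq V.
Proof.
apply: (@allpairs_uniq_dep _ _ _ (fun t k => (t, k) : label)).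
- exact: iota_uniq.
- by move=> t _; exact: iota_uniq.
- by move=> [t k] [t' k'] _ _ [-> ->].
Qed.

Lemma sum_labels (f : label -> nat) :
  \sum_(v <- V) f v = \sum_(t < 10) \sum_(k < type_size x t) f (t : nat, k : nat).
Proof.
rewrite /labels big_flatten big_map.
rewrite -(big_mkord xpredT (fun t => \sum_(k < type_size x t) f (t, k : nat))).
apply: eq_bigr => t _; rewrite big_map -(big_mkord xpredT (fun k => f (t, k))).
by rewrite /index_iota subn0.
Qed.

Lemma rows_gt0 : 0 < R. Proof. by []. Qed.

Lemma sedge_sym : symmetric (sedge x).
Proof. by move=> u v; rewrite /sedge orbC. Qed.

Lemma sedge_irr : irreflexive (sedge x).
Proof.
move=> [t k]; rewrite /sedge orbb /edge /hub_edge /= eqxx.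
by do 10?[case: t => [|t] //=]; rewrite ?andbF ?orbF //= ?andbF.
Qed.

Lemma sum_window_le b k c (p : pred 'I_b) :
  (forall i, p i -> k <= i < k + c) -> \sum_(i < b) p i <= c.
Proof.
move=> pkc; have -> : \sum_(i < b) p i = #|p|.
  by rewrite -sum1_card [RHS]big_mkcond; apply: eq_bigr => i _; rewrite unfold_in; case: (p i).
rewrite cardE -(size_map val) -[leqRHS](size_iota k); apply: uniq_leq_size.
  by rewrite map_inj_uniq ?enum_uniq //; exact: val_inj.
by move=> _ /mapP[i + ->]; rewrite mem_enum mem_iota; exact: pkc.
Qed.

Lemma sum_bool_le b (p : pred 'I_b) : \sum_(i < b) p i <= b.
Proof.
rewrite -[leqRHS]card_ord -sum1_card; apply: leq_sum => i _; exact: leq_b1.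
Qed.

Lemma bag_size q : count (bag x q) V <= R + 12.
Proof.
have -> : count (bag x q) V = \sum_(v <- V) bag x q v.
  by rewrite -sum1_count big_mkcond; apply: eq_bigr => v _; case: (bag _ _ _).
rewrite sum_labels; case: q => [|k].
  pose c t := if t == 8 then R + 12 else 0.
  apply: (@leq_trans (\sum_(t < 10) c t)).
    apply: leq_sum => t _; rewrite /bag /c /=; case: eqP => [->|_]; last by rewrite big1_eq.
    by rewrite sum_nat_const card_ord muln1.
  by rewrite /c; move: (R + 12) => r; rewrite !big_ord_recl big_ord0 /=; lia.
pose c t := if t == 0 then R.+1 else if t <= 7 then 1 else 2.
apply: (@leq_trans (\sum_(t < 10) c t)); last first.
  by rewrite /c; move: R => r; rewrite !big_ord_recl big_ord0 /=; lia.
apply: leq_sum => t _; rewrite /c /bag /=.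
have [t0|t0] := eqVneq (t : nat) 0; first by apply: (@sum_window_le _ k) => i; lia.
have [t7|t7] := leqP t 7.
  have [t6|t6] := eqVneq (t : nat) 7.
    by apply: (@sum_window_le _ (k %/ R)) => i; lia.
  by apply: (@sum_window_le _ k) => i; lia.
have [t8|t8] := eqVneq (t : nat) 8.
  by apply: (@sum_window_le _ 0) => i; lia.
have -> : nat_of_ord t = 9 by have := ltn_ord t; lia.
exact: sum_bool_le.
Qed.

Lemma bag_cover : {in V, forall v, exists2 q, q \in bag_indices x & bag x q v}.
Proof.
move=> [t k]; rewrite mem_labels => /andP[t10 kt].
have R0 := rows_gt0.
have [t6|t6] := leqP t 6.
  exists k.+1; first by move: kt; rewrite /type_size t6 mem_iota; lia.
  by rewrite /bag /=; lia.
have [t8|t8] := eqVneq t 8; first by exists 0; rewrite ?mem_iota // /bag t8.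
have [t7|t7] := eqVneq t 7; last first.
  by exists 1; rewrite ?mem_iota // /bag /=; lia.
move: kt; rewrite /type_size t7 /= => kL.
exists (k * R).+1; last by rewrite /bag /= mulnK ?eqxx.
by rewrite mem_iota /cells /=; nia.
Qed.

Lemma bag_edge : {in V &, forall u v, sedge x u v ->
  exists2 q, q \in bag_indices x & bag x q u && bag x q v}.
Proof.
have R0 := rows_gt0.
suff H : {in V &, forall u v, edge x u v ->
  exists2 q, q \in bag_indices x & bag x q u && bag x q v}.
  move=> u v uV vV /orP[/H|/H]; first exact.
  by case=> // q qQ; rewrite andbC; exists q.
move=> [t k] [t' k']; rewrite !mem_labels => /andP[t10 kt] /andP[t10' kt'].
have qM q : q <= M.+1 -> q \in bag_indices x by rewrite mem_iota.
have cellk i t0 : t0 <= 6 -> i < type_size x t0 -> i.+1 <= M.+1.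
  by rewrite /type_size => ->; lia.
rewrite /edge /=.
case: (leqP t 6) => [t6|t6].
  (* [edge] lists such an edge from its left end, whose bag contains type 0 up to one column
     further. *)
  have kM := cellk _ _ t6 kt; move=> e; exists k.+1; first exact: qM.
  move: e {cellk kM kt kt' t10 t10'}; rewrite /bag /=.
  by do 7?[case: t t6 => [|t] //= t6]; rewrite ?orbF; lia.
case: (eqVneq t 7) => [-> /=|t7].
  rewrite !orbF => /and3P[t3 /eqP <- _].
  have kM : k' < M.+1 by apply: cellk kt'; lia.
  by exists k'.+1; [exact: qM | rewrite /bag /= eqxx; lia].
case: (eqVneq t 8) kt => [-> kt|t8 kt].
  rewrite /= orbF => /orP[/andP[/eqP-> hubk']|/andP[t8 _]].
    have [t'6|t'6] := leqP t' 6.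
      have kM := cellk _ _ t'6 kt'.
      by exists k'.+1; [exact: qM | rewrite /bag /=; lia].
    by move: hubk' t'6; rewrite /hub_edge /= => /or3P[]/andP[]; lia.
  by exists 0; rewrite ?qM // /bag /= t8.
have -> : t = 9 by lia.
move=> /= /andP[t'8 /eqP kk']; exists 1; first exact: qM.
rewrite /bag /=; move: kt; rewrite /type_size -kk'.
have -> : t = 9 by lia.
by rewrite /=; lia.
Qed.

Lemma bag_interval i j k v : v \in V -> i <= j -> j <= k ->
  k < size (bag_indices x) ->
  bag x (nth 0 (bag_indices x) i) v -> bag x (nth 0 (bag_indices x) k) v ->
  bag x (nth 0 (bag_indices x) j) v.
Proof.
case: v => t l vV ij jk; rewrite /bag_indices size_iota => kM.
rewrite !nth_iota ?add0n; [|lia..].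
case: j ij jk => [|j] ij jk; first by have -> : i = 0 by lia.
case: k kM jk => [|k] kM jk; first by lia.
have jkR := leq_div2r R (jk : j <= k); rewrite /bag /= {vV kM}.
case: i ij => [|i] ij /=; first by move=> /eqP->; lia.
move: (leq_div2r R (ij : i <= j)) jkR.
move: (i %/ R) (j %/ R) (k %/ R) => i' j' k' ij' jk'.
by do 9?[case: t => [|t] /=]; rewrite ?andbF ?orbF; lia.
Qed.

Definition clique_labels : pred label := fun v => v.1 == 8.

Lemma clique_sedge u v : clique_labels u -> clique_labels v -> u != v -> sedge x u v.
Proof.
case: u v => [t k] [t' k'] /eqP/= -> /eqP/= ->.
by rewrite xpair_eqE eqxx /= /sedge /edge /= => ->; rewrite orbT.
Qed.

Lemma sum_clique : \sum_(v <- V) clique_labels v = R + 12.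
Proof.
rewrite sum_labels.
have -> : R + 12 = \sum_(t < 10) (if t == 8 :> nat then R + 12 else 0).
  by move: (R + 12) => r; rewrite !big_ord_recl big_ord0 /=; lia.
apply: eq_bigr => t _; rewrite /clique_labels /=.
case: eqP => [->|_]; last by rewrite big1_eq.
by rewrite sum_nat_const card_ord muln1.
Qed.

Definition cnf_graph : sgraph := label_graph (0, 0) V sedge_sym sedge_irr.

Definition cnf_bags : seq {set 'I_(nverts cnf_graph)} :=
  @label_bags _ (0, 0) V _ (bag_indices x) (bag x).

Lemma cnf_bags_decomp : path_decomp cnf_bags.
Proof.
apply: (label_bags_decomp _ sedge_sym sedge_irr labels_uniq (q0 := 0)).
- exact: bag_cover.
- exact: bag_edge.
- exact: bag_interval.
Qed.

Lemma cnf_graph_pathwidth :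
  pathwidth cnf_graph = R + 11 /\ width cnf_bags = pathwidth cnf_graph.
Proof.
have cardK : #|[set i : 'I_(size V) | clique_labels (nth (0, 0) V i)]| = R + 12.
  by rewrite -sum_clique; exact: esym (sum_lab _ _ _).
have -> : R + 11 = #|[set i : 'I_(size V) | clique_labels (nth (0, 0) V i)]|.-1.
  by rewrite cardK; lia.
apply: pathwidth_clique; first exact: cnf_bags_decomp.
  move=> i j; rewrite !inE => iK jK ij; apply: clique_sedge => //.
  by rewrite nth_uniq ?labels_uniq.
rewrite cardK; apply: width_label_bags => q _.
by apply: leq_trans (bag_size q) _; rewrite addnS.
Qed.

End Labels.

Section Neighbours.
Variable x : raw_cnf.
Local Notation R := (rows x).
Local Notation M := (cells x).

Ltac by_type t := rewrite /sedge /edge /hub_edge /=;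
  do 10?[case: t => [|t] /=]; rewrite ?andbF ?orbF //=; try lia.

Lemma nbr4 t l k : sedge x (t, l) (4, k) -> (l == k) && ((t == 2) || (t == 3)).
Proof. by by_type t. Qed.

Lemma nbr5 t l k : sedge x (t, l) (5, k) -> (l == k) && ((t == 0) || (t == 1)).
Proof. by by_type t. Qed.

Lemma nbr9 t l k : sedge x (t, l) (9, k) -> (l == k) && (t == 8).
Proof. by by_type t. Qed.

(** Beyond the first column the hub is not a neighbour; types 5, 6 and 7 will be excluded by the
    budget. *)
Lemma nbr0 t l k : R <= k -> sedge x (t, l) (0, k) ->
  [|| (t == 2) && (l == k), (t == 3) && (k == l + R), t == 5, t == 6 | t == 7].
Proof. by move=> Rk; by_type t. Qed.

Lemma nbr6 t l k : k + R < M -> sedge x (t, l) (6, k) ->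
  (t == 1) && (l == k) || (t == 0) && (l == k + R).
Proof. by move=> kM; by_type t. Qed.

Lemma nbr7 t l j : sedge x (t, l) (7, j) ->
  [&& t <= 3, l %/ R == j & lit_of x (t, l) \in clause_of x j].
Proof. by by_type t. Qed.

End Neighbours.

Definition dominating (x : raw_cnf) (X : pred label) : Prop :=
  {in labels x, forall v, exists2 u, u \in labels x & X u && sedge x u v}.

Definition raw_sat (x : raw_cnf) : Prop :=
  exists a : nat -> bool, all (has (fun l => a l.1 == l.2)) x.2.

(** * From a small dominating set to an assignment *)

Section DominatingToSat.
Variables (x : raw_cnf) (X : pred label).
Local Notation R := (rows x).
Local Notation M := (cells x).
Local Notation L := (columns x).
Local Notation V := (labels x).
Local Notation m := (size x.2).
Hypotheses (domX : dominating x X) (smallX : \sum_(v <- V) X v <= budget x).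

Lemma dominated t k : t < 10 -> k < type_size x t ->
  exists t' k', [/\ t' < 10, k' < type_size x t', X (t', k') & sedge x (t', k') (t, k)].
Proof.
move=> t10 kt; have [|[t' k']] := domX (x := (t, k)).
  by rewrite mem_labels t10.
by rewrite mem_labels => /andP[? ?] /andP[? ?]; exists t', k'.
Qed.

Lemma pair01 k : k < M -> 1 <= X (0, k) + X (1, k).
Proof.
move=> kM; have [//|t [l [_ _ Xtl /nbr5/andP[/eqP<-]]]] := @dominated 5 k isT.
by case/orP=> /eqP tE; rewrite -tE Xtl; lia.
Qed.

Lemma pair23 k : k < M -> 1 <= X (2, k) + X (3, k).
Proof.
move=> kM; have [//|t [l [_ _ Xtl /nbr4/andP[/eqP<-]]]] := @dominated 4 k isT.
by case/orP=> /eqP tE; rewrite -tE Xtl; lia.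
Qed.

Lemma forced8 k : k < 2 -> X (8, k).
Proof.
move=> k2; have [//|t [l [_ _ Xtl /nbr9/andP[/eqP<- /eqP<-]]]] := @dominated 9 k isT.
exact: Xtl.
Qed.

Lemma sum_eq_pointwise b (f g : 'I_b -> nat) : (forall i, f i <= g i) ->
  \sum_i g i <= \sum_i f i -> forall i, f i = g i.
Proof.
move=> fg gf i; apply/eqP; rewrite eqn_leq fg /= leqNgt; apply/negP => lt.
suff : \sum_i f i < \sum_i g i by lia.
rewrite (bigD1 i) // [ltnRHS](bigD1 i) //=.
by rewrite -addSn leq_add // leq_sum.
Qed.

(* The lower bounds coming from disjoint neighbourhoods exhaust the budget. *)
Lemma tight :
  [/\ forall k, k < M -> X (0, k) + X (1, k) = 1,
      forall k, k < M -> X (2, k) + X (3, k) = 1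
    & forall t k, 5 <= t <= 7 -> k < type_size x t -> X (t, k) = false].
Proof.
pose S t := \sum_(k < type_size x t) X (t, k : nat).
have S01 : S 0 + S 1 = \sum_(k < M) (X (0, k : nat) + X (1, k : nat)).
  by rewrite big_split.
have S23 : S 2 + S 3 = \sum_(k < M) (X (2, k : nat) + X (3, k : nat)).
  by rewrite big_split.
have M1 : \sum_(k < M) 1 = M by rewrite sum1_card card_ord.
have S01M : M <= S 0 + S 1.
  by rewrite S01 -[leqLHS]M1 leq_sum // => k _; exact: pair01.
have S23M : M <= S 2 + S 3.
  by rewrite S23 -[leqLHS]M1 leq_sum // => k _; exact: pair23.
have S8 : 2 <= S 8.
  have t8 : type_size x 8 = 2 + (R + 10) by rewrite /type_size /=; lia.
  by rewrite /S t8 big_split_ord /= 2!big_ord_recl big_ord0 /= !forced8.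
have : \sum_(t < 10) S t <= 2 * M + 2 by rewrite -(sum_labels x (fun v => X v)).
have sum10 (f : nat -> nat) : \sum_(t < 10) f t =
    f 0 + f 1 + f 2 + f 3 + f 4 + f 5 + f 6 + f 7 + f 8 + f 9.
  by rewrite !big_ord_recr big_ord0.
rewrite sum10 => tot.
have S567 t : 5 <= t <= 7 -> S t = 0.
  by move=> t57; have : t \in [:: 5; 6; 7] by [rewrite !inE; lia];
    rewrite !inE => /or3P[]/eqP->; lia.
split.
- move=> k kM;
  apply: esym (@sum_eq_pointwise M (fun=> 1)
    (fun i => X (0, i : nat) + X (1, i : nat)) _ _ (Ordinal kM)).
    by move=> i; exact: pair01.
  by rewrite -S01 M1; lia.
- move=> k kM;
  apply: esym (@sum_eq_pointwise M (fun=> 1)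
    (fun i => X (2, i : nat) + X (3, i : nat)) _ _ (Ordinal kM)).
    by move=> i; exact: pair23.
  by rewrite -S23 M1; lia.
- move=> t k t57 kt; have /eqP := S567 t t57.
  by rewrite sum_nat_eq0 => /forallP/(_ (Ordinal kt)); case: (X _).
Qed.

(** The vertex [(6, k)] needs [(1, k)] or [(0, k + R)], and the budget rules out [(1, k)] next to
    [(0, k)]. *)
Lemma type0_mono k : k + R < M -> X (0, k) -> X (0, k + R).
Proof.
have [E01 _ _] := tight; move=> kM X0.
have kM' : k < M by lia.
have [//|t [l [_ _ Xtl /(nbr6 kM)/orP[]]]] := @dominated 6 k isT.
  by case/andP=> /eqP tE /eqP lE; move: Xtl (E01 k kM'); rewrite tE lE X0 => ->.
by case/andP=> /eqP tE /eqP lE; rewrite -lE -tE.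
Qed.

(** Within the budget, [(0, k + R)] can only be dominated by [(3, k)] from the left or by
    [(2, k + R)] in its own cell, and [(3, k)] is not chosen next to [(2, k)]. *)
Lemma type2_mono k : k + R < M -> X (2, k) -> X (2, k + R).
Proof.
have [_ E23 E567] := tight; move=> kM X2.
have kM' : k < M by lia.
have [//|t [l [t10 lt Xtl]]] := @dominated 0 (k + R) isT.
move/(nbr0 (leq_addl _ _))/or4P=> [/andP[/eqP<- /eqP<-]//|/andP[/eqP t3 /eqP kl]|t5|t67].
- by move: Xtl (E23 k kM'); rewrite t3 -(addIn kl) X2 => ->.
- by rewrite E567 // in Xtl; rewrite (eqP t5).
- by rewrite E567 // in Xtl; case/orP: t67 => /eqP->.
Qed.

Definition col_bit t j i := X (t, j * R + i).

Lemma col_bit_mono t j j' i : (t == 0) || (t == 2) -> i < R -> j <= j' -> j' < L ->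
  col_bit t j i <= col_bit t j' i.
Proof.
move=> t02 iR; elim: j' => [|j' IHj]; first by rewrite leqn0 => /eqP->.
rewrite leq_eqVlt => /orP[/eqP->//|jj'] j'L; apply: leq_trans (IHj jj' (ltnW j'L)) _.
have kM : j' * R + i + R < M by rewrite /cells; nia.
have -> : col_bit t j'.+1 i = X (t, j' * R + i + R).
  by rewrite /col_bit mulSn -addnA addnC.
rewrite /col_bit.
case E : (X (t, j' * R + i)) => //.
case/orP: t02 E => /eqP-> /= E.
  by rewrite type0_mono.
by rewrite type2_mono.
Qed.

Definition col_sum j := \sum_(i < R) (col_bit 0 j i + col_bit 2 j i).

Lemma col_sum_le j : col_sum j <= 2 * R.
Proof.
rewrite mulnC -[X in X * _]card_ord -sum_nat_const leq_sum // => i _.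
by case: (col_bit 0 j i); case: (col_bit 2 j i).
Qed.

Lemma col_sum_mono j j' : j <= j' -> j' < L -> col_sum j <= col_sum j'.
Proof. by move=> jj' j'L; rewrite leq_sum // => i _; rewrite leq_add // col_bit_mono. Qed.

(* A monotone quantity bounded by [2 R] is constant on one of [2 R + 1]
   consecutive blocks of columns. *)
Lemma constant_block : 0 < m ->
  exists2 c, c <= 2 * R & col_sum (c * m + m.-1) = col_sum (c * m).
Proof.
move=> m0; pose P c := col_sum (c * m + m.-1) == col_sum (c * m).
have [/existsP[c /eqP cP]|/existsPn nP] := boolP [exists c : 'I_(2 * R).+1, P c].
  by exists (c : nat) => //; rewrite -ltnS.
(* If no block is constant, each one raises [col_sum] by at least 1, which exceeds the bound [2 * R]
   after the last. *)
suff grow c : c <= 2 * R -> c < col_sum (c * m + m.-1).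
  by have := grow (2 * R) (leqnn _); have := col_sum_le (2 * R * m + m.-1); lia.
elim: c => [|c IHc] cR.
  have := nP (inord 0); rewrite /P inordK //.
  have : col_sum (0 * m) <= col_sum (0 * m + m.-1).
    by apply: col_sum_mono; rewrite ?leq_addr // /columns; nia.
  by lia.
have := IHc (ltnW cR); have := nP (inord c.+1); rewrite /P inordK //.
have : col_sum (c.+1 * m) <= col_sum (c.+1 * m + m.-1).
  by apply: col_sum_mono; rewrite ?leq_addr // /columns; nia.
have : col_sum (c * m + m.-1) <= col_sum (c.+1 * m).
  by apply: col_sum_mono; rewrite /columns; nia.
by lia.
Qed.

Lemma dominating_raw_sat : raw_sat x.
Proof.
have [m0|m0] := posnP m; first by exists xpredT; rewrite (size0nil m0).
have [c cR cE] := constant_block m0.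
have blockL q : q < m -> c * m + q < L by rewrite /columns; nia.
have const q t i : q < m -> (t == 0) || (t == 2) -> i < R ->
    col_bit t (c * m + q) i = col_bit t (c * m) i.
  move=> qm t02 iR.
  (* No bit decreases along the block and their sum does not increase, so each bit is constant. *)
  have mono t' (i' : 'I_R) : (t' == 0) || (t' == 2) ->
      col_bit t' (c * m) i' <= col_bit t' (c * m + q) i'.
    by move=> t'02; rewrite col_bit_mono ?leq_addr ?blockL.
  have qE : col_sum (c * m + q) <= col_sum (c * m).
    by rewrite -cE col_sum_mono ?blockL //; lia.
  have := sum_eq_pointwise (fun i' => leq_add (mono 0 i' isT) (mono 2 i' isT)) qE
    (Ordinal iR).
  have := mono 0 (Ordinal iR) isT; have := mono 2 (Ordinal iR) isT.
  by case/orP: t02 => /eqP-> /=; do 4?case: (col_bit _ _ i).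
(* The assignment is read off the first column of the constant block. *)
exists (fun v => if odd v then col_bit 2 (c * m) v./2 else col_bit 0 (c * m) v./2).
apply/(all_nthP [::]) => q qm; pose j := c * m + q.
have jE : clause_of x j = nth [::] x.2 q.
  by rewrite /clause_of prednK // /j modnMDl modn_small.
have [//||t [k [_ kt Xtk]]] := @dominated 7 j; first exact: blockL.
move/nbr7/and3P=> [t3 /eqP kj]; rewrite jE => lC.
apply/hasP; exists (lit_of x (t, k)) => //=.
have kM : k < M by move: kt; rewrite /type_size (leq_trans t3).
have iR : k %% R < R by rewrite ltn_mod.
have kE : k = j * R + k %% R by rewrite -kj -divn_eq.
have [E01 E23 _] := tight.
rewrite oddD oddM andbF /= halfD oddM andbF /= muln2 doubleK.
have Xbit t' : (t' == 0) || (t' == 2) -> col_bit t' (c * m) (k %% R) = X (t', k).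
  by move=> t'02; rewrite -(const q) // /col_bit -/j -kE.
case: t t3 lC kt Xtk => [|[|[|[|t]]]] //= _ _ _ Xtk;
  rewrite ?addn0 ?add0n Xbit //; move: Xtk (E01 k kM) (E23 k kM);
  by do 4?case: (X _).
Qed.

End DominatingToSat.

(** * From an assignment to a dominating set *)

Section SatToDominating.
Variables (x : raw_cnf) (a : nat -> bool).
Local Notation R := (rows x).
Local Notation M := (cells x).
Local Notation L := (columns x).
Hypothesis vars_lt : all (all (fun l => l.1 < x.1)) x.2.
Hypothesis a_sat : all (has (fun l => a l.1 == l.2)) x.2.

Definition sat_labels : pred label := fun v =>
  if v.1 <= 3 then a (lit_of x v).1 == (lit_of x v).2 else (v.1 == 8) && (v.2 <= 1).
Local Notation X := sat_labels.

Lemma sat_labels01 k : X (0, k) + X (1, k) = 1.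
Proof. by rewrite /X /lit_of /=; case: (a _). Qed.

Lemma sat_labels23 k : X (2, k) + X (3, k) = 1.
Proof. by rewrite /X /lit_of /=; case: (a _). Qed.

Lemma sat_labelsD t k : t <= 3 -> X (t, k + R) = X (t, k).
Proof. by move=> t3; rewrite /X /lit_of /= modnDr t3. Qed.

Lemma sat_labels_sum : \sum_(v <- labels x) X v <= budget x.
Proof.
rewrite sum_labels.
pose S t := \sum_(k < type_size x t) X (t, k : nat).
rewrite -[leqLHS]/(\sum_(t < 10) S t) !big_ord_recr big_ord0 /=.
have S01 : S 0 + S 1 = M.
  rewrite /S -big_split /= -[RHS]card_ord -sum1_card.
  by apply: eq_bigr => k _; exact: sat_labels01.
have S23 : S 2 + S 3 = M.
  rewrite /S -big_split /= -[RHS]card_ord -sum1_card.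
  by apply: eq_bigr => k _; exact: sat_labels23.
have S8 : S 8 <= 2.
  by apply: (@sum_window_le _ 0) => k; rewrite /X /=; lia.
have S0 t : 3 < t -> t != 8 -> S t = 0.
  by move=> t3 t8; rewrite /S big1 // => k _; rewrite /X /= leqNgt t3 (negPf t8).
by rewrite /budget (S0 4) // (S0 5) // (S0 6) // (S0 7) // (S0 9) //; lia.
Qed.

Lemma sat_labels_dominating : dominating x X.
Proof.
have R0 := rows_gt0 x.
have hub v : hub_edge x v -> exists2 u, u \in labels x & X u && sedge x u v.
  move=> hv; exists (8, 0); first by rewrite mem_labels /type_size /= addn_gt0 R0.
  by rewrite /X /sedge /edge /= hv /= ?orbT.
move=> [t k]; rewrite mem_labels => /andP[t10 kt].
have in_cell t' k' : t' <= 6 -> k' < M -> (t', k') \in labels x.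
  by move=> t6 k'M; rewrite mem_labels /type_size t6 k'M andbT; lia.
have kM : t <= 6 -> k < M by move: kt; rewrite /type_size; case: ifP.
case: t t10 kt kM => [_ _ /(_ isT) kM|].
  have [kR|Rk] := ltnP k R; first by apply: hub; rewrite /hub_edge /= kR.
  have [X2|X2] := boolP (X (2, k)).
    exists (2, k); first exact: in_cell.
    by rewrite X2 /sedge /edge /= eqxx.
  (* All columns make the same choice, so [(3, k)] being chosen gives [(3, k - R)], a neighbour in
     the previous column. *)
  exists (3, k - R); first by apply: in_cell => //; lia.
  have := sat_labels23 k; rewrite (negPf X2) -[in X (3, k)](subnK Rk) sat_labelsD //.
  by case: (X _) => // _; rewrite /sedge /edge /= subnK // eqxx.
case=> [_ _ /(_ isT) kM|]; first by apply: hub; rewrite /hub_edge.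
case=> [_ _ /(_ isT) kM|]; first by apply: hub; rewrite /hub_edge.
case=> [_ _ /(_ isT) kM|]; first by apply: hub; rewrite /hub_edge.
case=> [_ _ /(_ isT) kM|].
  have := sat_labels23 k; case X2 : (X (2, k)) => /=.
    by exists (2, k); rewrite ?in_cell // X2 /sedge /edge /= eqxx.
  case X3 : (X (3, k)) => // _.
  by exists (3, k); rewrite ?in_cell // X3 /sedge /edge /= eqxx.
case=> [_ _ /(_ isT) kM|].
  have := sat_labels01 k; case X0 : (X (0, k)) => /=.
    by exists (0, k); rewrite ?in_cell // X0 /sedge /edge /= eqxx.
  case X1 : (X (1, k)) => // _.
  by exists (1, k); rewrite ?in_cell // X1 /sedge /edge /= eqxx.
case=> [_ _ /(_ isT) kM|].
  have [Mk|kRM] := leqP M (k + R); first by apply: hub; rewrite /hub_edge /= Mk.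
  have := sat_labels01 k; case X0 : (X (0, k)) => /=.
    exists (0, k + R); first exact: in_cell.
    by rewrite sat_labelsD // X0 /sedge /edge /= eqxx.
  case X1 : (X (1, k)) => // _.
  by exists (1, k); rewrite ?in_cell // X1 /sedge /edge /= eqxx.
case=> [_ kL _|].
  have m0 : 0 < size x.2 by move: kL; rewrite /type_size /columns /=; lia.
  have cF : clause_of x k \in x.2 by rewrite mem_nth // prednK // ltn_mod.
  have /hasP[[v b] lC /= /eqP avb] := allP a_sat _ cF.
  have /= vx := allP (allP vars_lt _ cF) _ lC.
  have vR : v./2 < R by rewrite ltnS half_leq // ltnW.
  pose t := (if odd v then 2 else 0) + ~~ b.
  have litE : lit_of x (t, k * R + v./2) = (v, b).
    rewrite /lit_of /= modnMDl modn_small // muln2 /t -[in RHS](odd_double_half v).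
    by rewrite addnC; case: (odd v); case: (b).
  have t3 : t <= 3 by rewrite /t; case: (odd v); case: (b).
  exists (t, k * R + v./2).
    by apply: in_cell; [lia | move: kL; rewrite /type_size /cells /=; nia].
  rewrite /X t3 litE avb eqxx /sedge /edge /= t3 litE lC.
  by rewrite divnMDl // divn_small // addn0 eqxx ?orbT.
case=> [_ _ _|].
  have [->|k0] := eqVneq k 0.
    (* Neighbourhoods are open: the hub does not dominate itself, the second forced clique vertex
       does it. *)
    exists (8, 1); first by rewrite mem_labels /type_size /=; lia.
    by [].
  exists (8, 0); first by rewrite mem_labels /type_size /=; lia.
  by rewrite /X /sedge /edge /= eq_sym k0 ?orbT.
case=> [_ k2 _|//].
exists (8, k); first by rewrite mem_labels /type_size /=; move: k2; rewrite /type_size /=; lia.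
by rewrite /X /sedge /edge /= eqxx ?orbT andbT.
Qed.

End SatToDominating.

Lemma has_tds_cnf_graph (x : raw_cnf) : all (all (fun l => l.1 < x.1)) x.2 ->
  has_tds (cnf_graph x) (budget x) <-> raw_sat x.
Proof.
move=> vars_lt; split.
  move=> /(has_tds_labelP _ _ _ (labels_uniq x))[X smallX domX].
  exact: dominating_raw_sat domX smallX.
move=> [a a_sat]; apply/(has_tds_labelP _ _ _ (labels_uniq x)).
exists (sat_labels x a); first exact: sat_labels_sum.
exact: sat_labels_dominating.
Qed.

(** * The reduction in polynomial time *)

Ltac ptime_step :=
  first [assumption | match goal with
  | |- ptime (fun _ => ?a) => apply: ptime_const
  | |- ptime (fun y => @?a y || @?b y) => apply: (@ptime_orb _ _ a b)
  | |- ptime (fun y => @?a y && @?b y) => apply: (@ptime_andb _ _ a b)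
  | |- ptime (fun y => ~~ @?a y) => apply: (@ptime_negb _ _ a)
  | |- ptime (fun y => @eq_op Datatypes_nat__canonical__eqtype_Equality (@?a y) (@?b y)) =>
      apply: (@ptime_eqn _ _ a b)
  | |- ptime (fun y => @eq_op Datatypes_bool__canonical__eqtype_Equality (@?a y) (@?b y)) =>
      apply: (@ptime_eqb _ _ a b)
  | |- ptime (fun y => @?a y <= @?b y) => apply: (@ptime_leq _ _ a b)
  | |- ptime (fun y => @?a y + @?b y) => apply: (@ptime_addn _ _ a b)
  | |- ptime (fun y => @?a y * @?b y) => apply: (@ptime_muln _ _ a b)
  | |- ptime (fun y => (@?a y)./2) => apply: (@ptime_half _ _ a)
  | |- ptime (fun y => (@?a y, @?b y)) => apply: (@ptime_pair _ _ _ _ _ _ a b)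
  | |- ptime (fun y => (@?a y).-1) => apply: (@ptime_pred _ _ a)
  | |- ptime (fun y => (@?a y).+1) => apply: (@ptime_S _ _ a)
  | |- ptime (fun y => @?a y %/ @?b y) => apply: (@ptime_divn _ _ a b)
  | |- ptime (fun y => @?a y %% @?b y) => apply: (@ptime_modn _ _ a b)
  | |- ptime (fun y => size (@?a y)) => apply: (@ptime_size _ _ _ _ a)
  | |- ptime (fun y => nth [::] (@?a y) (@?b y)) => apply: (@ptime_nth _ _ _ _ a b)
  | |- ptime (fun y => iota 0 (@?a y)) => apply: (@ptime_iota0 _ _ a)
  | |- ptime (fun y => (@?a y).1) => apply: (@ptime_fst _ _ _ _ _ _ a)
  | |- ptime (fun y => (@?a y).2) => apply: (@ptime_snd _ _ _ _ _ _ a)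
  | |- ptime (fun y => y) => apply: ptime_id
  | |- _ => apply: ptime_if
  end].

Section PtimeGraph.
Variables (X : Type) (eX : encoder X) (f : X -> raw_cnf).
Hypothesis pf : ptime f.

Lemma ptime_rows : ptime (fun y => rows (f y)).
Proof. by rewrite /rows; repeat ptime_step. Qed.

Lemma ptime_columns : ptime (fun y => columns (f y)).
Proof. by have pR := ptime_rows; rewrite /columns; repeat ptime_step. Qed.

Lemma ptime_cells : ptime (fun y => cells (f y)).
Proof.
by have pR := ptime_rows; have pL := ptime_columns; rewrite /cells; repeat ptime_step.
Qed.

Lemma ptime_clause_of (g : X -> nat) : ptime g -> ptime (fun y => clause_of (f y) (g y)).
Proof. by move=> pg; rewrite /clause_of; repeat ptime_step. Qed.

Lemma ptime_lit_of (u : X -> label) : ptime u -> ptime (fun y => lit_of (f y) (u y)).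
Proof.
by move=> pu; have pR := ptime_rows; rewrite /lit_of /nat_of_bool; repeat ptime_step.
Qed.

Lemma ptime_mem_lit (l : X -> nat * bool) (s : X -> raw_clause) :
  ptime l -> ptime s -> ptime (fun y => l y \in s y).
Proof.
move=> pl ps.
apply: (@ptime_ext _ _ _ _
  (fun y => has (fun l' => (l'.1 == (l y).1) && (l'.2 == (l y).2)) (s y))).
  by move=> y; rewrite -has_pred1; apply: eq_has => -[p q]; case: (l y).
apply: (@ptime_has _ _ _ _ _ (fun y l' => (l'.1 == (l y).1) && (l'.2 == (l y).2))) => //.
have pl' : ptime (fun y : X * (nat * bool) => l y.1).
  exact: (ptime_comp (ptime_fst (ptime_id _)) pl).
by repeat ptime_step.
Qed.

Lemma ptime_edge (u v : X -> label) :
  ptime u -> ptime v -> ptime (fun y => edge (f y) (u y) (v y)).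
Proof.
move=> pu pv; have pR := ptime_rows; have pM := ptime_cells.
have pl := ptime_lit_of pv.
have pc := ptime_clause_of (ptime_snd pu).
have pm := ptime_mem_lit pl pc.
by rewrite /edge /hub_edge; repeat ptime_step.
Qed.

Lemma ptime_bag (q : X -> nat) (v : X -> label) :
  ptime q -> ptime v -> ptime (fun y => bag (f y) (q y) (v y)).
Proof.
by move=> pq pv; have pR := ptime_rows; rewrite /bag; repeat ptime_step.
Qed.

Lemma ptime_type_size (t : X -> nat) : ptime t ->
  ptime (fun y => type_size (f y) (t y)).
Proof.
move=> pt; have pR := ptime_rows; have pL := ptime_columns; have pM := ptime_cells.
by rewrite /type_size; repeat ptime_step.
Qed.

End PtimeGraph.

Lemma ptime_labels X (eX : encoder X) (f : X -> raw_cnf) :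
  ptime f -> ptime (fun y => labels (f y)).
Proof.
move=> pf; apply: (ptime_comp pf (g := labels)).
rewrite /labels; apply: ptime_flatten.
apply: (@ptime_map _ _ _ _ _ _ _
  (fun x t => [seq (t, k) | k <- iota 0 (type_size x t)])).
  exact: ptime_const.
apply: (@ptime_map _ _ _ _ _ _ _ (fun (y : raw_cnf * nat) k => (y.2, k))).
  exact: (ptime_iota0 (ptime_type_size (ptime_fst (ptime_id _)) (ptime_snd (ptime_id _)))).
by repeat ptime_step.
Qed.

Definition tds_instance (x : raw_cnf) : seq (seq bool) * (nat * seq (seq bool)) :=
  ([seq [seq sedge x u v | v <- labels x] | u <- labels x],
   (budget x, [seq [seq bag x q v | v <- labels x] | q <- bag_indices x])).

Lemma ptime_tds_instance : ptime tds_instance.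
Proof.
have px := ptime_id (enc_of_prod enc_of_nat (enc_of_seq (enc_of_seq
  (enc_of_prod enc_of_nat enc_of_bool)))).
apply: ptime_pair.
  apply: (@ptime_map _ _ _ _ _ _ _ (fun x u => [seq sedge x u v | v <- labels x])).
    exact: ptime_labels.
  apply: (@ptime_map _ _ _ _ _ _ _ (fun (y : raw_cnf * label) v => sedge y.1 y.2 v)).
    exact: (ptime_labels (ptime_fst (ptime_id _))).
  have py := ptime_id (enc_of_prod (enc_of_prod (enc_of_prod enc_of_nat (enc_of_seq
    (enc_of_seq (enc_of_prod enc_of_nat enc_of_bool)))) (enc_of_prod enc_of_nat enc_of_nat))
    (enc_of_prod enc_of_nat enc_of_nat)).
  have [p1 p2] := (ptime_fst (ptime_fst py), ptime_snd (ptime_fst py)).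
  have p3 := ptime_snd py.
  exact: (ptime_orb (ptime_edge p1 p2 p3) (ptime_edge p1 p3 p2)).
apply: ptime_pair.
  have pM := ptime_cells px; rewrite /budget; by repeat ptime_step.
apply: (@ptime_map _ _ _ _ _ _ _ (fun x q => [seq bag x q v | v <- labels x])).
  have pM := ptime_cells px; rewrite /bag_indices; by repeat ptime_step.
apply: (@ptime_map _ _ _ _ _ _ _ (fun (y : raw_cnf * nat) v => bag y.1 y.2 v)).
  exact: (ptime_labels (ptime_fst (ptime_id _))).
have py := ptime_id (enc_of_prod (enc_of_prod (enc_of_prod enc_of_nat (enc_of_seq
  (enc_of_seq (enc_of_prod enc_of_nat enc_of_bool)))) enc_of_nat)
  (enc_of_prod enc_of_nat enc_of_nat)).
exact: (ptime_bag (ptime_fst (ptime_fst py)) (ptime_snd (ptime_fst py)) (ptime_snd py)).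
Qed.

Lemma enc_tds_cnf_graph (x : raw_cnf) :
  enc_tds (G := cnf_graph x) (budget x) (cnf_bags x) = code (tds_instance x).
Proof.
rewrite /enc_tds enc_label_graph; congr (Node _ (Node _ _)).
rewrite /cnf_bags /label_bags /tds_instance.
elim: (bag_indices x) => //= q s IHs; congr Node; last exact: IHs.
exact: (enc_set_lab (0, 0) (labels x) (bag x q)).
Qed.

(** * Size of a [q]-CNF *)

Section CnfSize.
Variables (n : nat).

Definition raw_of (F : cnf n) : raw_cnf :=
  (n, [seq [seq (nat_of_ord l.1, l.2) | l <- c] | c <- F]).

Lemma code_raw_of (F : cnf n) : enc_cnf F = code (raw_of F).
Proof.
rewrite /enc_cnf; congr Node; rewrite /= /enc_of_seq.
by elim: F => //= c F ->; congr Node; elim: c => //= l c ->.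
Qed.

Lemma raw_of_vars (F : cnf n) : all (all (fun l => l.1 < n)) (raw_of F).2.
Proof.
apply/allP => c /mapP[c' _ ->]; apply/allP => l /mapP[l' _ ->] /=.
exact: ltn_ord.
Qed.

Lemma satP (F : cnf n) : sat F <-> raw_sat (raw_of F).
Proof.
split=> [/existsP[a satF]|[a satF]].
  exists (fun v => if insub v is Some i then a i else false).
  rewrite all_map; apply: sub_all satF => c; rewrite /preim /= has_map.
  by apply: sub_has => l /=; rewrite valK.
apply/existsP; exists [ffun i : 'I_n => a i].
move: satF; rewrite all_map; apply: sub_all => c; rewrite /preim /= has_map.
by apply: sub_has => l /=; rewrite ffunE.
Qed.

(** A clause of at most [q] literals, padded with [None], is a function from ['I_q] to the [2 n + 1]
    optional literals. The padding determines the length, so distinct clauses give distinct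
    functions. *)
Lemma qcnf_size q (F : cnf n) : qcnf q F -> size F <= (n * 2).+1 ^ q.
Proof.
move=> /andP[uF sF].
pose f (c : seq ('I_n * bool)) := [ffun i : 'I_q => nth None (map Some c) i].
have f_inj : {in F &, injective f}.
  move=> c d /(allP sF) cq /(allP sF) dq fcd.
  have nthE i : nth None (map Some c) i = nth None (map Some d) i.
    have [iq|qi] := ltnP i q; first by have /ffunP/(_ (Ordinal iq)) := fcd; rewrite !ffunE.
    by rewrite !nth_default ?size_map // (leq_trans _ qi).
  have nthS (s : seq ('I_n * bool)) i : (nth None (map Some s) i == None) = (size s <= i).
    by elim: s i => [|a s IHs] [|i] //=.
  have scd : size c = size d.
    by apply/eqP; rewrite eqn_leq -nthS nthE nthS leqnn -nthS -nthE nthS leqnn.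
  apply: (inj_map (@Some_inj _)); apply: (@eq_from_nth _ None) => [|i _].
    by rewrite !size_map.
  exact: nthE.
rewrite -(size_map f) -(card_uniqP _); last by rewrite map_inj_in_uniq.
apply: leq_trans (max_card _) _.
by rewrite card_ffun card_option card_prod !card_ord card_bool.
Qed.

End CnfSize.

Lemma qcnf_esize q : exists c k, forall n (F : cnf n), qcnf q F ->
  esize (raw_of F) <= c * n.+1 ^ k.
Proof.
suff [c [k H]] : polyb succn (fun n => n.*2.+3 + (n * 2).+1 ^ q * (q * (n.*2 + 6) + 2)).
  exists c, k => n F qF; apply: leq_trans (H n); have sz := qcnf_size qF.
  have clause_le : {in F, forall c0,
      (esize [seq (nat_of_ord l.1, l.2) | l <- c0]).+1 <= q * (n.*2 + 6) + 2}.
    move=> c0 c0F; case/andP: qF => _ /allP/(_ _ c0F) c0q.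
    apply: (@leq_trans (size c0 * (n.*2 + 6) + 2)).
      elim: c0 {c0F c0q} => // l c0 IHc0.
      rewrite [map _ _]/= esize_cons esize_pair esize_nat.
      move: IHc0 (ltn_ord l.1) (esize_bool l.2); rewrite /= mulSn.
      by set e2 := esize (map _ c0); set e1 := esize l.2; lia.
    by rewrite leq_add2r leq_mul2r c0q orbT.
  rewrite /raw_of esize_pair esize_nat esize_seq big_map.
  have : \sum_(c0 <- F) (esize [seq (nat_of_ord l.1, l.2) | l <- c0]).+1
      <= (n * 2).+1 ^ q * (q * (n.*2 + 6) + 2).
    apply: leq_trans (_ : \sum_(c0 <- F) (q * (n.*2 + 6) + 2) <= _).
      by rewrite !big_seq leq_sum.
    by rewrite big_const_seq count_predT iter_addn_0 mulnC leq_mul2r sz orbT.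
  by set S := \sum_(_ <- _) _; lia.
have S0 n : 0 < n.+1 by [].
have lin a b : polyb succn (fun n => a * n + b) by exists (a + b), 1 => n; nia.
apply: polyb_add => //.
  by apply: polyb_le (lin 2 3) => n; lia.
apply: polyb_mul; first by exists (2 ^ q), q => n; rewrite -expnMn; case: (q) => // q';
  rewrite leq_exp2r; lia.
by apply: polyb_le (lin (2 * q) (q * 6 + 2)) => n; nia.
Qed.

(** * The running time of the reduction *)

Lemma exec_gt0 c s t s' : exec c s t s' -> 0 < t.
Proof.
by elim=> // c1 c2 u s1 s2 t1 t2 _ t10 _ t20; rewrite addn_gt0 t10.
Qed.

Lemma polyb_exp (A : Type) (m f : A -> nat) k :
  polyb m f -> polyb m (fun x => f x ^ k).
Proof.
move=> pf; apply: (@polyb_comp _ _ _ id f (fun n => n ^ k)) => //.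
by exists 1, k => n; rewrite mul1n.
Qed.

Lemma complete_graph_irr n : irreflexive (fun i j : 'I_n => i != j).
Proof. by move=> i; rewrite eqxx. Qed.

Lemma complete_graph_sym n : symmetric (fun i j : 'I_n => i != j).
Proof. by move=> i j; rewrite eq_sym. Qed.

(** As [eps] may exceed 4, the base might be negative or 0. Graphs of known pathwidth exclude this,
    since every execution takes at least one step. *)
Definition complete_graph n : sgraph :=
  SGraph (@complete_graph_sym n) (@complete_graph_irr n).

Lemma pathwidth_complete n (D := [:: [set: 'I_n]]) :
  pathwidth (complete_graph n) = n.-1 /\
  @width (complete_graph n) D = pathwidth (complete_graph n).
Proof.
have pdD : @path_decomp (complete_graph n) D := path_decomp_trivial (complete_graph n).
have := @pathwidth_clique (complete_graph n) D [set: 'I_n] pdD.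
rewrite cardsT card_ord; apply; first by [].
by rewrite /width /D big_seq1 cardsT card_ord.
Qed.

Local Open Scope ring_scope.

(** * From the base of the exponential to the exponent of SAT *)

Section Exponents.
Variable R : realType.
Implicit Types a : R.

(* The time bound must be positive on [K_1] and on [K_2]. *)
Lemma tds_base_gt0 a : tds_solvable_in a -> 0 < a.
Proof.
move=> [P [C [k H]]].
have pos n : 0 < C * a ^+ n.
  have [pwn wn] := pathwidth_complete n.+1.
  have [t [s [/exec_gt0 t0 _]]] := H _ 0%N _ (path_decomp_trivial _) wn.
  rewrite pwn /= => tC; have : 0 < t%:R :> R by rewrite ltr0n.
  by move=> /lt_le_trans/(_ tC); rewrite pmulr_lgt0 // exprn_gt0 // ltr0n.
have := pos 1%N; have := pos 0%N; rewrite expr0 mulr1 expr1 => C0.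
by rewrite pmulr_rgt0.
Qed.

Lemma tds_qsat_time a q : tds_solvable_in a ->
  exists (P : cmd) (A : R) (K : nat), forall n (F : cnf n), qcnf q F ->
    decides_within P (enc_cnf F) (sat F) (A * Num.max 1 a ^+ n./2 * n.+1%:R ^+ K).
Proof.
move=> tds_a; have a0 := tds_base_gt0 tds_a.
(* The bound also has to absorb the time for building the instance, which a base below 1 could not
   do. *)
have [P [C [k H]]] := tds_a; set b := Num.max 1 a.
have b1 : 1 <= b by rewrite le_max lexx.
have [Q [c [l HQ]]] := ptime_then P ptime_tds_instance.
have [c1 [k1 instS]] := ptime_tds_instance.1.
have [c2 [k2 rawS]] := qcnf_esize q.
have pn : polyb succn (fun n => c2 * n.+1 ^ k2)%N by exists c2, k2.
have [A1 [K1 H1]] : polyb succn (fun n => (c1 * (c2 * n.+1 ^ k2) ^ k1) ^ k)%N.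
  apply: polyb_exp; apply: polyb_mul; first exact: polyb_const.
  exact: polyb_exp.
have [A2 [K2 H2]] : polyb succn (fun n => c * (c2 * n.+1 ^ k2) ^ l)%N.
  by apply: polyb_mul; [exact: polyb_const | exact: polyb_exp].
(* The pathwidth is [n./2 + 12], hence the power of [b]; [A2] pays for the reduction. *)
exists Q, (`|C| * b ^+ 12 * A1%:R + A2%:R), (K1 + K2)%N => n F qF.
set x := raw_of F; have xS := rawS n F qF.
have [pwE wE] := cnf_graph_pathwidth x.
have [t [s [eP s0 tP]]] := H (cnf_graph x) (budget x) _ (cnf_bags_decomp x) wE.
move: eP tP; rewrite enc_tds_cnf_graph => /HQ[t' eQ t'P] tP.
exists t', s; split; first by rewrite code_raw_of.
  rewrite s0; congr enc_bool; apply/idP/idP.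
    by move/(has_tds_cnf_graph (raw_of_vars F))/satP.
  by move/satP/(has_tds_cnf_graph (raw_of_vars F)).
have tS : (tsize (code (tds_instance x)) ^ k <= A1 * n.+1 ^ K1)%N.
  apply: leq_trans (H1 n); case: (k) => // k'; rewrite leq_exp2r //.
  apply: leq_trans (instS x) _; rewrite leq_mul2l; apply/orP; right.
  by case: (k1) => // k1'; rewrite leq_exp2r.
have t2 : (c * esize x ^ l <= A2 * n.+1 ^ K2)%N.
  apply: leq_trans (H2 n); rewrite leq_mul2l; apply/orP; right.
  by case: (l) => // l'; rewrite leq_exp2r.
have n1 : 1 <= n.+1%:R :> R by rewrite ler1n.
have bn1 : 1 <= b ^+ n./2 by rewrite exprn_ege1.
apply: (@le_trans _ _ (t%:R + (c * esize x ^ l)%:R)); first by rewrite -natrD ler_nat.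
rewrite !mulrDl; apply: lerD.
  apply: le_trans tP _; rewrite pwE /rows /=.
  apply: (@le_trans _ _ (`|C| * b ^+ (n./2 + 12) * (A1%:R * n.+1%:R ^+ K1))).
    rewrite -!natrX -natrM.
    apply: (@le_trans _ _ (`|C| * b ^+ (n./2 + 12) *
       (tsize (code (tds_instance x)) ^ k)%:R)); last first.
      by rewrite ler_wpM2l ?ler_nat // mulr_ge0 // exprn_ge0 // (le_trans ler01).
    rewrite natrX ler_wpM2r ?exprn_ge0 //.
    apply: (@le_trans _ _ (`|C| * a ^+ (n./2.+1 + 11))).
      by rewrite ler_wpM2r ?ler_norm // exprn_ge0 // ltW.
    rewrite addSnnS ler_wpM2l // lerXn2r ?nnegrE ?(ltW a0) //.
      by rewrite (le_trans ler01).
    by rewrite le_max lexx orbT.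
  rewrite exprD exprD.
  have -> : `|C| * (b ^+ n./2 * b ^+ 12) * (A1%:R * n.+1%:R ^+ K1) =
     `|C| * b ^+ 12 * A1%:R * b ^+ n./2 * n.+1%:R ^+ K1 * 1 by ring.
  rewrite [leRHS]mulrA ler_wpM2l ?exprn_ege1 //.
  by rewrite !mulr_ge0 ?exprn_ge0 // (le_trans ler01).
apply: (@le_trans _ _ (A2%:R * n.+1%:R ^+ K2)).
  by rewrite -natrX -natrM ler_nat.
have -> : A2%:R * b ^+ n./2 * n.+1%:R ^+ (K1 + K2) =
   A2%:R * n.+1%:R ^+ K2 * (b ^+ n./2 * n.+1%:R ^+ K1) by rewrite exprD; ring.
by rewrite ler_peMr ?mulr_ge0 ?exprn_ge0 // mulr_ege1 // exprn_ege1.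
Qed.

(** With [k = K + 1], never 0, one has [n + 1 <= (1 + k / eta) * (1 + eta * n / k)]. The last factor
    is at most [expR (eta * n / k)], and the [k]-th power gives the claim. *)
Lemma poly_le_exp (eta : R) K : 0 < eta ->
  exists A : R, forall n : nat, n.+1%:R ^+ K <= A * expR (eta * n%:R).
Proof.
move=> eta0; pose k := K.+1; have k0 : 0 < k%:R :> R by rewrite ltr0n.
exists ((1 + k%:R / eta) ^+ k) => n.
have n0 : 0 <= n%:R :> R by [].
apply: (@le_trans _ _ (n.+1%:R ^+ k)).
  by rewrite exprS ler_peMl ?exprn_ge0 // ler1n.
have -> : expR (eta * n%:R) = expR (eta * n%:R / k%:R) ^+ k.
  by rewrite -expRM_natl; congr expR; field; rewrite gt_eqF.
rewrite -exprMn lerXn2r ?nnegrE ?mulr_ge0 ?expR_ge0 ?addr_ge0 ?divr_ge0 ?(ltW eta0) //.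
apply: (@le_trans _ _ ((1 + k%:R / eta) * (1 + eta * n%:R / k%:R))).
  have -> : (1 + k%:R / eta) * (1 + eta * n%:R / k%:R) =
     n.+1%:R + k%:R / eta + eta * n%:R / k%:R.
    by rewrite -natr1; field; rewrite !gt_eqF.
  by rewrite -addrA lerDl addr_ge0 ?divr_ge0 ?mulr_ge0 // ltW.
by rewrite ler_wpM2l ?expR_ge1Dx // addr_ge0 ?divr_ge0 // ltW.
Qed.

(** [lam] is the growth rate of [b ^+ n./2], below [ln 2] because [b < 4]. Half of the gap absorbs
    the polynomial factor, whatever its degree, so [delta] is the same for all [q]. *)
Lemma tds_qsat_exponent a : a < 4 -> tds_solvable_in a ->
  exists2 delta : R, delta < 1 & forall q, qsat_solvable_in q delta.
Proof.
move=> a4 tds_a; set b := Num.max 1 a.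
have b1 : 1 <= b by rewrite le_max lexx.
have b0 : 0 < b by exact: lt_le_trans ltr01 b1.
have b4 : b < 4 by rewrite gt_max a4 andbT; lra.
have ln2 : 0 < ln 2 :> R by rewrite ln_gt0 //; lra.
have lnb : ln b < 2 * ln 2.
  have -> : 2 * ln 2 = ln 4 :> R.
    have -> : 4 = 2 * 2 :> R by ring.
    by rewrite lnM ?posrE //; ring.
  by rewrite ltr_ln ?posrE.
pose lam := ln b / 2; pose eta := (ln 2 - lam) / 2.
have eta0 : 0 < eta by rewrite /eta /lam; lra.
pose delta := (lam + eta) / ln 2.
exists delta; first by rewrite ltr_pdivrMr // mul1r /eta /lam; lra.
move=> q; have [P [A [K H]]] := tds_qsat_time q tds_a.
have [B HB] := poly_le_exp K eta0.
exists P, (`|A| * B) => n F qF; have [t [s [eP s0 tP]]] := H n F qF.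
exists t, s; split=> //; apply: le_trans tP _.
apply: (@le_trans _ _ (`|A| * b ^+ n./2 * n.+1%:R ^+ K)).
  rewrite !ler_wpM2r ?exprn_ge0 ?ler_norm // ltW //.
have -> : 2 `^ (delta * n%:R) = expR (lam * n%:R) * expR (eta * n%:R).
  rewrite /powR ifF; last by apply/eqP; lra.
  rewrite -expRD; congr expR; rewrite /delta; field; exact: lt0r_neq0.
rewrite -mulrA; set e1 := expR (lam * _); set e2 := expR (eta * _).
have -> : `|A| * B * (e1 * e2) = `|A| * (e1 * (B * e2)) by ring.
rewrite ler_wpM2l // ler_pM ?exprn_ge0 ?(ltW b0) // /e1.
rewrite -[b in leLHS]lnK ?posrE // -expRM_natl ler_expR /lam.
have -> : ln b / 2 * n%:R = ln b * (n%:R / 2) by ring.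
rewrite mulrC ler_wpM2l ?ln_ge0 // ler_pdivlMr // -natrM ler_nat.
by rewrite muln2 -[leqRHS]odd_double_half leq_addl.
Qed.

End Exponents.

Theorem theorem8p4 (R : realType) :
  (exists eps : R, 0 < eps /\ tds_solvable_in (4 - eps)) -> ~ SETH R.
Proof.
move=> [eps [eps0 tds_eps]] seth.
have [|delta delta1 qsat] := tds_qsat_exponent _ tds_eps; first by lra.
(* The infimum of a set without lower bound is 0 by convention, hence the maximum with 0. *)
have exp_le q : sat_exponent R q <= Num.max delta 0.
  rewrite /sat_exponent le_max.
  set E := (X in inf X); have Edelta : E delta by exact: qsat.
  have [lbE|nlbE] := pselect (has_lbound E).
    by rewrite (ge_inf lbE Edelta).
  by rewrite inf_out ?lexx ?orbT // => -[_ /nlbE].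
have max1 : Num.max delta 0 < 1 by rewrite gt_max delta1 ltr01.
have [N _ /(_ N (leqnn N))] := cvgr_gt _ seth _ max1.
by rewrite ltNge exp_le.
Qed.
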